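(* Let $d>1$ and let $\pi\in\mathfrak{S}_d^0$. The set of $[\lambda]\in\mathbb{P}_+^{d-1}$ such that the interval exchange transformation $f([\lambda],\pi)$ is not uniquely ergodic has Hausdorff dimension strictly less than $d-1$.
   Context: $\mathfrak{S}_d^0$ is the set of irreducible permutations of $\{1,\dots,d\}$, i.e. permutations $\pi$ with $\pi(\{1,\dots,k\})\neq\{1,\dots,k\}$ for every $1\le k<d$. $\mathbb{R}_+^d$ is the set of vectors with positive coordinates and $\mathbb{P}_+^{d-1}$ its projectivization. For $\lambda\in\mathbb{R}_+^d$ split $I=[0,\sum_i\lambda_i)$ into consecutive subintervals $I_1,\dots,I_d$ (left to right, closed on the left, open on the right) with $|I_i|=\lambda_i$. The interval exchange transformation $f(\lambda,\pi):I\to I$ is $f(x)=x+\sum_{\pi(j)<\pi(i)}\lambda_j-\sum_{j<i}\lambda_j$ for $x\in I_i$. Rescaling $\lambda$ conjugates $f(\lambda,\pi)$ by a dilation, so one writes $f([\lambda],\pi)$. Uniquely ergodic means that normalized Lebesgue measure is the only $f$-invariant Borel probability measure. *)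

(* Defs.v *)
From HB Require Import structures.
From mathcomp Require Import all_boot all_order all_algebra all_fingroup.
From mathcomp Require Import generic_quotient.
From mathcomp Require Import all_classical all_reals all_analysis.
Set Implicit Arguments.
Unset Strict Implicit.
Unset Printing Implicit Defensive.
Import Order.TTheory GRing.Theory Num.Theory.
Import numFieldNormedType.Exports.
Local Open Scope quotient_scope.
Local Open Scope classical_set_scope.
Local Open Scope ring_scope.

(* Indices are 0-based throughout: 'I_d = {0, ..., d-1} plays {1, ..., d}. *)
Definition irreducible_perm (d : nat) (p : 'S_d) : Prop :=
  forall k : nat, (1 <= k < d)%N ->
    (p @: [set i : 'I_d | (i < k)%N] <> [set i : 'I_d | (i < k)%N])%SET.

(* [diam set0 = -oo], and [poweR -oo s = 0] for s > 0, so that empty sets may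
   be used to pad a cover into a sequence. *)
Definition diam (R : realType) (T : metricType R) (A : set T) : \bar R :=
  ereal_sup [set (mdist x.1 x.2)%:E | x in A `*` A].

Definition hausdorff_premeasure (R : realType) (T : metricType R) (s e : R)
    (A : set T) : \bar R :=
  ereal_inf [set (\sum_(0 <= n <oo) poweR (diam (U n)) s)%E
    | U in [set U : nat -> set T |
        A `<=` \bigcup_n U n /\ forall n, (diam (U n) <= e%:E)%E]].

(* The s-dimensional Hausdorff measure; meaningful for s > 0 only, since
   padding by empty sets is not free for s = 0. *)
Definition hausdorff_measure (R : realType) (T : metricType R) (s : R)
    (A : set T) : \bar R :=
  ereal_sup [set hausdorff_premeasure s e A | e in [set e : R | 0 < e]].

Definition hausdorff_dim (R : realType) (T : metricType R) (A : set T) : \bar R :=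
  ereal_inf [set s%:E | s in [set s : R | 0 < s /\ hausdorff_measure s A = 0%E]].

Definition posvec (R : realType) (d : nat) : Type :=
  {l : 'rV[R]_d | [forall i, 0 < l 0 i]}.
HB.instance Definition _ (R : realType) (d : nat) :=
  Choice.on (posvec R d).

Definition vec_sum (R : realType) (d : nat) (l : 'rV[R]_d) : R := \sum_i l 0 i.

Section projectivization.
Variables (R : realType) (d : nat).
Implicit Types l m : posvec R d.

Definition proportional l m : bool :=
  `[< exists2 t : R, 0 < t & val m = t *: val l >].

Lemma proportional_refl : reflexive proportional.
Proof. by move=> l; apply/asboolP; exists 1; rewrite ?scale1r. Qed.

Lemma proportional_sym : symmetric proportional.
Proof.
suff H l m : proportional l m -> proportional m l.
  by move=> l m; apply/idP/idP; exact: H.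
move=> /asboolP[t t0 E]; apply/asboolP; exists t^-1; rewrite ?invr_gt0//.
by rewrite E scalerA mulVf ?scale1r// gt_eqF.
Qed.

Lemma proportional_trans : transitive proportional.
Proof.
move=> m l k /asboolP[t t0 E] /asboolP[u u0 F]; apply/asboolP.
by exists (u * t); rewrite ?mulr_gt0// F E scalerA.
Qed.

Canonical proportional_equiv :=
  EquivRel proportional proportional_refl proportional_sym proportional_trans.

Definition Pplus : Type := {eq_quot proportional}.
HB.instance Definition _ := Choice.on Pplus.
HB.instance Definition _ := EqQuotient.on Pplus.

(* The affine chart of the projective space that sends P_+ onto the open
   standard simplex. *)
Definition simplex_chart (x : Pplus) : 'rV[R]_d :=
  (vec_sum (val (repr x)))^-1 *: val (repr x).

Lemma vec_sum_ge0 l : 0 <= vec_sum (val l).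
Proof. by apply: sumr_ge0 => i _; apply/ltW/(forallP (valP l)). Qed.

Lemma vec_sum_eq0 l : vec_sum (val l) = 0 -> d = 0%N.
Proof.
move=> /eqP; rewrite psumr_eq0 => [/allP h|i _]; last first.
  exact/ltW/(forallP (valP l)).
case: (posnP d) => // d0; have := h (Ordinal d0) (mem_index_enum _).
by rewrite /= gt_eqF// (forallP (valP l)).
Qed.

(* The chart does not depend on the representative. *)
Lemma simplex_chartE l :
  simplex_chart (\pi_Pplus l) = (vec_sum (val l))^-1 *: val l.
Proof.
rewrite /simplex_chart; set m := repr _.
have /asboolP[t t0 ->] : proportional l m.
  by rewrite -(eqquotE Pplus) /m reprK.
rewrite /vec_sum; under eq_bigr do rewrite mxE.
rewrite -mulr_sumr invfM scalerA mulrAC mulVf ?mul1r// gt_eqF//.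
Qed.

Lemma simplex_chart_inj : injective simplex_chart.
Proof.
move=> x y; rewrite -[x]reprK -[y]reprK !simplex_chartE.
set l := repr x; set m := repr y => E; apply/eqP; rewrite (eqquotE Pplus).
apply/asboolP.
have [d0|dN0] := eqVneq d 0%N.
  by exists 1 => //; apply/rowP => -[i id]; exfalso; move: id; rewrite d0.
have tP (k : posvec R d) : 0 < vec_sum (val k).
  rewrite lt_neqAle vec_sum_ge0 andbT eq_sym; apply: contra dN0 => /eqP /vec_sum_eq0.
  by move/eqP.
exists (vec_sum (val m) / vec_sum (val l)); first by rewrite divr_gt0.
by rewrite -scalerA E scalerA mulfV ?scale1r// gt_eqF.
Qed.

(* Sup-norm distance in the simplex chart. The simplex has compact closure in
   the affine chart, so on P_+ this is bi-Lipschitz equivalent to (the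
   restriction of) any Riemannian distance of the projective space, hence gives
   the same Hausdorff dimension. *)
Definition Pplus_dist (x y : Pplus) : R :=
  `|simplex_chart x - simplex_chart y|.

Lemma Pplus_distxx x : Pplus_dist x x = 0.
Proof. by rewrite /Pplus_dist subrr normr0. Qed.

Lemma Pplus_dist_positivity x y : Pplus_dist x y = 0 -> x = y.
Proof.
by move=> /normr0_eq0/eqP; rewrite subr_eq0 => /eqP; exact: simplex_chart_inj.
Qed.

Lemma Pplus_dist_sym x y : Pplus_dist x y = Pplus_dist y x.
Proof. exact: distrC. Qed.

Lemma Pplus_dist_triangle y x z :
  Pplus_dist x z <= Pplus_dist x y + Pplus_dist y z.
Proof. exact: ler_distD. Qed.

HB.instance Definition _ := isMetric.Build R Pplus
  Pplus_distxx Pplus_dist_positivity Pplus_dist_sym Pplus_dist_triangle.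

End projectivization.

Section iet.
Variables (R : realType) (d : nat) (l : 'rV[R]_d) (p : 'S_d).

Definition iet_dom : set R := [set x | 0 <= x < vec_sum l].

Definition iet_left (i : 'I_d) : R := \sum_(j < d | (j < i)%N) l 0 j.

Definition in_piece (i : 'I_d) (x : R) : bool :=
  iet_left i <= x < iet_left i + l 0 i.

(* The outer sum has exactly one term for x in the domain, and is empty
   outside of it. *)
Definition iet (x : R) : R :=
  x + \sum_(i < d | in_piece i x)
        (\sum_(j < d | (p j < p i)%N) l 0 j - \sum_(j < d | (j < i)%N) l 0 j).

(* Borel probability measures on the domain are encoded as Borel probability
   measures on R giving it mass 1. *)
Definition iet_invariant (mu : probability (measurableTypeR R) R) : Prop :=
  mu iet_dom = 1%E /\
  forall A : set (measurableTypeR R), measurable A ->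
    mu (iet_dom `&` iet @^-1` A) = mu A.

Definition uniquely_ergodic : Prop :=
  forall mu : probability (measurableTypeR R) R,
    iet_invariant mu <->
    forall A : set (measurableTypeR R), measurable A ->
      mu A = (lebesgue_measure (A `&` iet_dom) * ((vec_sum l)^-1)%:E)%E.

End iet.

Definition not_uniquely_ergodic_locus (R : realType) (d : nat) (p : 'S_d) :
    set (Pplus R d) :=
  [set \pi_(Pplus R d) l | l in
     [set l : posvec R d | ~ uniquely_ergodic (val l) p]].

Arguments not_uniquely_ergodic_locus R {d} p _.

(* Main.v *)
(* Rauzy induction writes the vector of lengths as [l = y *m C], where [y] are the
   lengths of an induced exchange and [C] is a product of elementary matrices; the
   simplex spanned by the rows of [C] has volume proportional to the product
   [weight] of the inverses of the row sums [height] of [C]. If infinitely often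
   the induction performs a step whose matrix is positive with bounded entries,
   then Birkhoff contraction shows that all invariant measures give proportional
   masses to the exchanged intervals, and the exchange is uniquely ergodic. So, up
   to countably many projective maps, it suffices to cover the vectors whose
   induction never performs such a good step.

   From every cone, a definite proportion of the weight reaches a good step before
   the heights are multiplied by a constant (Kerckhoff): the probability that the
   letter [x] loses against [a] is [height x / (height x + height a)], after which
   [x] has height [height x + height a], so a letter of large height is unlikely to
   become much larger without winning. Iterating, the bad cones have total weight at
   most [kap ^ j] while their heights are at most [K ^ j]; hence the sum of
   [weight ^ (1 - eta)] over the bad cones tends to 0 for some [eta > 0]. Finally a
   simplex of volume [w] in dimension [n] is covered by about [w / w ^ n] cubes of
   side [w], which bounds its contribution to the [(n - eta)]-dimensional Hausdorff
   sums by [w ^ (1 - eta)]. *)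
Require Import Defs.
From mathcomp Require Import all_boot all_order all_algebra all_fingroup.
From mathcomp Require Import all_classical all_reals all_analysis.
From HB Require Import structures.
From mathcomp Require Import measurable_realfun.
From mathcomp Require Import zify ring lra.
Set Implicit Arguments.
Unset Strict Implicit.
Unset Printing Implicit Defensive.
Import Order.TTheory GRing.Theory Num.Theory.
Import numFieldNormedType.Exports.

(** * Rauzy induction on permutations *)

(** The obstacle is an unbalanced node. A letter of large height beats one of small height only with
    small probability, so a prescribed path has a definite probability only when the letters
    competing along it have comparable heights. Hence a downward induction ([recurrent]) on the
    number [k] of letters whose height is comparable to the bound [M] on all heights. If only [k]
    letters are large, irreducibility brings a small letter into competition after boundedly many
    moves; a supermartingale then shows that, with probability at least one half, a further letter
    becomes large before the height of any large one is multiplied by [D = 2 * n.+1]. No probability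
    space is built: [weight] is additive on the tree, and a stopping time is a finite list of nodes
    covering the bad vectors ([coverable]). The bound on the heights travels with each cover because
    [1 / weight] is a product of [n.+1] heights. *)

Section reinsertion.
Variables k n : nat.

(** A cycle on positions: the last one, [n], lands just to the right of [k], which will be the
    winner's position in the losing row. *)
Definition reinsert_nat i := if i <= k then i else if i == n then k.+1 else i.+1.

Lemma reinsert_nat_last i : k < n -> i <= n ->
  (reinsert_nat i < k.+1) && (i != k) = (i < k).
Proof.
by rewrite /reinsert_nat; case: (leqP i k) => ? ? ?; case: (i =P n) => ?; lia.
Qed.

Lemma reinsert_nat_gt i : k < n -> i < n ->
  (k < reinsert_nat i) = (k.+1 < reinsert_nat i).
Proof.
by rewrite /reinsert_nat; case: (leqP i k) => ? ? ?; case: (i =P n) => ?; lia.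
Qed.

Lemma reinsert_nat_mono i j : i < n -> j < n ->
  (reinsert_nat i < reinsert_nat j) = (i < j).
Proof.
rewrite /reinsert_nat; case: (leqP i k) => ?; case: (leqP j k) => ? ? ?.
all: by case: (i =P n) => ?; case: (j =P n) => ?; lia.
Qed.
End reinsertion.

Section Rauzy.
Variable n : nat.
Implicit Types (k : 'I_n.+1) (e : bool).

Definition reinsert_fun k (i : 'I_n.+1) : 'I_n.+1 :=
  if (i <= k)%N then i
  else if i == ord_max then inord k.+1 else inord i.+1.

Lemma val_reinsert_fun k i :
  reinsert_fun k i = reinsert_nat k n i :> nat.
Proof.
rewrite /reinsert_fun /reinsert_nat -val_eqE /=; have := ltn_ord i; have := ltn_ord k.
case: (leqP i k) => // ?; case: eqP => *; rewrite ?inordK //; lia.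
Qed.

Lemma reinsert_fun_inj k : injective (reinsert_fun k).
Proof.
move=> i j /(congr1 (@nat_of_ord _)); rewrite !val_reinsert_fun /reinsert_nat => H.
apply/val_inj => /=; have := ltn_ord i; have := ltn_ord j; have := ltn_ord k; move: H.
by case: (leqP i k) => ?; case: (leqP j k) => ?; do ?case: eqP => ?; lia.
Qed.

Definition reinsert k : 'S_n.+1 := perm (@reinsert_fun_inj k).

(* [s.1 i] and [s.2 i] are the positions of the letter [i] in the top and in the
   bottom row. *)
Definition state := ('S_n.+1 * 'S_n.+1)%type.
Implicit Types s : state.

(** The move [e = true] lets the last letter of the top row win, so that [winner (~~ e) s] denotes
    the loser of the move [e] throughout. *)
Definition winner e s : 'I_n.+1 := ((if e then s.1 else s.2)^-1)%g ord_max.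

Definition rauzy e s : state :=
  if e then (s.1, (s.2 * reinsert (s.2 (winner e s)))%g)
  else ((s.1 * reinsert (s.1 (winner e s)))%g, s.2).

(** Exchanging the rows exchanges the two moves; this reduces the statements about a move to
    [e = true]. *)
Definition swap s : state := (s.2, s.1).

Definition run s (g : seq bool) : state := foldl (fun s e => rauzy e s) s g.

Definition irreducible s :=
  forall k : nat, 0 < k <= n ->
    [set i | s.1 i < k] <> [set i | s.2 i < k].

Lemma swapK : involutive swap. Proof. by case. Qed.

Lemma winner_swap e s : winner e (swap s) = winner (~~ e) s.
Proof. by case: e. Qed.

Lemma rauzy_swap e s : rauzy e (swap s) = swap (rauzy (~~ e) s).
Proof. by case: e. Qed.

Lemma irreducible_swap s : irreducible s -> irreducible (swap s).
Proof. by move=> h k /h H E; apply: H. Qed.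

Lemma pos_winner s : (s.1 (winner true s) = n :> nat) * (s.2 (winner false s) = n :> nat).
Proof. by split; rewrite /winner permKV. Qed.

Lemma rauzy_bottom s i :
  (rauzy true s).2 i = reinsert_nat (s.2 (winner true s)) n (s.2 i) :> nat.
Proof. by rewrite /= permM permE val_reinsert_fun. Qed.

Lemma rauzy_top s : (rauzy true s).1 = s.1. Proof. by []. Qed.

Lemma pos_inj (p : 'S_n.+1) i j : p i = p j :> nat -> i = j.
Proof. by move=> /val_inj/perm_inj. Qed.

Lemma lt_pos_bottom s i : i != winner false s -> s.2 i < n.
Proof.
move=> h; have := ltn_ord (s.2 i); rewrite ltnS leq_eqVlt => /orP[/eqP E|//].
by case/eqP: h; apply: (@pos_inj s.2); rewrite pos_winner.
Qed.

Lemma lt_pos_top s i : i != winner true s -> s.1 i < n.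
Proof. by move=> h; apply: (@lt_pos_bottom (swap s)). Qed.

Hypothesis n_gt0 : 0 < n.

(** Irreducibility at [k = n]: with equal last letters, the first [n] letters of both rows would
    form the same set. *)
Lemma winner_neq s : irreducible s -> winner true s != winner false s.
Proof.
move=> /(_ n); rewrite n_gt0 leqnn => /(_ isT) H; apply/eqP => E; apply: H.
apply/setP => i; rewrite !inE.
have [->|ia] := eqVneq i (winner true s).
  by rewrite pos_winner E pos_winner.
by rewrite lt_pos_top // lt_pos_bottom // -E.
Qed.

Lemma winner_neqb e s : irreducible s -> winner e s != winner (~~ e) s.
Proof. by move=> /winner_neq; case: e; rewrite //= eq_sym. Qed.

Lemma irreducible_rauzy e s : irreducible s -> irreducible (rauzy e s).
Proof.
wlog: e s / e => [H|->].
  move=> hs; case: e; first exact: H.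
  rewrite -[s]swapK rauzy_swap; apply: irreducible_swap; apply: H => //.
  exact: irreducible_swap.
move=> hs k hk E; apply: (hs k hk); apply/setP => i.
(* The winner is last in the top row, hence outside the common set; so [k] is at most its bottom
   position, and to the left of that position reinsertion changes nothing. *)
move/setP: E => E; have := E i; have := E (winner true s).
rewrite !inE rauzy_top !rauzy_bottom /reinsert_nat pos_winner.
rewrite leqnn; move: (ltn_ord (s.2 i)).
by case: (leqP (s.2 i) (s.2 _)) => ?; do ?case: eqP => ?; lia.
Qed.

Lemma irreducible_run s g : irreducible s -> irreducible (run s g).
Proof. by elim: g s => //= e g IH s hs; apply/IH/irreducible_rauzy. Qed.

Lemma run_cat s g h : run s (g ++ h) = run (run s g) h.
Proof. exact: foldl_cat. Qed.

Definition end_pair s : {set 'I_n.+1} := [set winner true s; winner false s].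

Lemma end_pairE e s : end_pair s = [set winner e s; winner (~~ e) s].
Proof. by case: e; rewrite // /end_pair finset.setUC. Qed.

Lemma winner_stays e s : winner e (rauzy e s) = winner e s.
Proof.
by case: e.
Qed.

Lemma winner_end_pair e s : winner e s \in end_pair s.
Proof. by rewrite (end_pairE e) !inE eqxx. Qed.

Section count.
Variable E : {set 'I_n.+1}.

(** The quantity that cannot increase while only letters of [E] compete. *)
Definition outside_before (p : 'S_n.+1) i := #|[set j | (j \notin E) && (p j < p i)]|.

Lemma outside_before_le p i : outside_before p i <= #|~: E|.
Proof. by apply: subset_leq_card; apply/fintype.subsetP => j; rewrite !inE => /andP[]. Qed.

Lemma outside_before_top s :
  winner true s \in E -> outside_before s.1 (winner true s) = #|~: E|.
Proof.
move=> aE; apply: eq_card => j; rewrite !inE; case: (boolP (j \in E)) => //= jE.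
rewrite pos_winner; apply: lt_pos_top; by apply: contra jE => /eqP->.
Qed.

Lemma outside_before_bottom s :
  winner false s \in E -> outside_before s.2 (winner false s) = #|~: E|.
Proof. exact: (@outside_before_top (swap s)). Qed.

(** The loser is put directly after the winner, with no outside letter in between, so it inherits
    the winner's count; the other letters keep their relative order. *)
Lemma outside_before_rauzy s i : irreducible s -> end_pair s \subset E ->
  outside_before (rauzy true s).2 i =
  outside_before s.2 (if i == winner false s then winner true s else i).
Proof.
move=> irrs sE; have aE : winner true s \in E.
    by apply: (fintype.subsetP sE); rewrite winner_end_pair.
have xE : winner false s \in E.
  by apply: (fintype.subsetP sE); rewrite winner_end_pair.
apply: eq_card => j; rewrite !inE; case: (boolP (j \in E)) => //= jE.
have jx : j != winner false s by apply: contra jE => /eqP->.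
have ja : s.2 j != s.2 (winner true s) :> nat.
  by apply: contra jE => /eqP/pos_inj->.
have ax := lt_pos_bottom (winner_neq irrs).
have := lt_pos_bottom jx; rewrite !rauzy_bottom /reinsert_nat.
have [->|ix] := eqVneq i (winner false s).
  rewrite pos_winner !eqxx (leqNgt n) ax /=.
  by case: (leqP (s.2 j) (s.2 (winner true s))) => ?; do ?case: eqP => ?; lia.
have := lt_pos_bottom ix.
by case: (leqP (s.2 j) (s.2 (winner _ _))) => ?;
  case: (leqP (s.2 i) (s.2 (winner _ _))) => ?; do ?case: eqP => ?; lia.
Qed.

(** Only the loser's count changes, and at the end of its row it was maximal. *)
Lemma outside_before_rauzy_le e s i : irreducible s -> end_pair s \subset E ->
  outside_before (rauzy e s).1 i + outside_before (rauzy e s).2 i <=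
  outside_before s.1 i + outside_before s.2 i.
Proof.
wlog: e s / e => [H|->] irrs sE.
  case: e; first exact: H.
  have := H true (swap s) isT (irreducible_swap irrs).
  rewrite rauzy_swap addnC [X in _ <= X]addnC; apply.
  by rewrite /end_pair !winner_swap finset.setUC.
rewrite leq_add2l outside_before_rauzy //; case: eqP => // ->.
rewrite outside_before_bottom ?outside_before_le //.
by apply: (fintype.subsetP sE); rewrite winner_end_pair.
Qed.

Lemma card_pos_lt (p : 'S_n.+1) (k : nat) : k <= n.+1 -> #|[set i | p i < k]| = k.
Proof.
move=> kn; have -> : [set i | p i < k] = p @^-1: [set i : 'I_n.+1 | i < k].
  by apply/setP => i; rewrite !inE.
rewrite card_preimset; last exact: perm_inj.
have wi : injective (widen_ord kn) by move=> i j /(congr1 val) /= /val_inj.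
rewrite -[RHS]card_ord -(card_imset 'I_k wi); apply: eq_card => i.
rewrite inE; apply/idP/imsetP => [ik|[j _ ->]]; last exact: (ltn_ord j).
by exists (Ordinal ik) => //; apply: val_inj.
Qed.

(** A full count at every letter of [E] means that each outside letter precedes each letter of [E],
    so the outside letters fill an initial segment. *)
Lemma pos_outside (p : 'S_n.+1) :
  (forall i, i \in E -> outside_before p i = #|~: E|) ->
  [set i | p i < #|~: E|] = ~: E.
Proof.
move=> H; have sep i j : i \in E -> j \notin E -> p j < p i.
  move=> iE jE; have /eqP := H i iE; rewrite eqn_leq => /andP[_ le].
  have : [set j | (j \notin E) && (p j < p i)] == ~: E.
    rewrite finset.eqEcard le andbT; apply/fintype.subsetP => l.
    by rewrite !inE => /andP[].
  by move=> /eqP/setP/(_ j); rewrite !inE jE.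
apply/setP => i; rewrite !inE; case: (boolP (i \in E)) => /= iE.
  apply/negbTE; rewrite -leqNgt -(card_pos_lt p (ltnW (ltn_ord (p i)))).
  apply: subset_leq_card; apply/fintype.subsetP => j; rewrite !inE; exact: sep.
rewrite -(@card_pos_lt p (p i).+1 (ltn_ord (p i))).
apply: subset_leq_card; apply/fintype.subsetP => j; rewrite !inE ltnS => ji.
by apply/negP => jE; have := sep _ _ jE iE; rewrite ltnNge ji.
Qed.

End count.

Lemma nat_argmin (T : Type) (f : T -> nat) (x0 : T) :
  exists x, forall y, f x <= f y.
Proof.
have [m] := ubnP (f x0); elim: m x0 => // m IH x0; rewrite ltnS => h.
have [H|/existsNP[y /negP]] := pselect (forall y, f x0 <= f y).
  by exists x0.
by rewrite -ltnNge => yx; apply: (IH y); apply: leq_trans yx h.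
Qed.

(* Once the set [E] of letters still to come and the number of outside letters
   in front of them can no longer decrease, all the outside letters precede the
   letters of [E] in both rows. *)
Lemma reach_letter s i : irreducible s -> exists g, i \in end_pair (run s g).
Proof.
move=> irrs; apply: contrapT => /forallNP noti.
pose E s := [set j | `[< exists g, j \in end_pair (run s g) >]].
have EP s0 j : reflect (exists g, j \in end_pair (run s0 g)) (j \in E s0).
  by rewrite inE; exact: asboolP.
have Erun s0 g : E (run s0 g) \subset E s0.
  apply/fintype.subsetP => j /EP[h hj]; apply/EP.
  by exists (g ++ h); rewrite run_cat.
have [g1 g1min] := nat_argmin (fun g => #|E (run s g)|) [::].
pose s1 := run s g1; pose E1 := E s1.
have E1run g : E (run s1 g) = E1.
  by apply/eqP; rewrite finset.eqEcard Erun -run_cat g1min.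
have E1i : i \notin E1.
  by apply/negP => /(fintype.subsetP (Erun _ _))/EP[h] /noti.
have E1end g : end_pair (run s1 g) \subset E1.
  by apply/fintype.subsetP => j jend; apply/EP; exists g.
pose c s j := outside_before E1 s.1 j + outside_before E1 s.2 j.
have irr1 g : irreducible (run s1 g) by do 2!apply: irreducible_run.
have c_le g h j : c (run s1 (g ++ h)) j <= c (run s1 g) j.
  elim: h g => [|e h IH] g; first by rewrite cats0.
  rewrite -cat_rcons; apply: leq_trans (IH _) _; rewrite -cats1 run_cat /=.
  exact: outside_before_rauzy_le (irr1 g) (E1end g).
have [g2 g2min] := nat_argmin (fun g => \sum_(j in E1) c (run s1 g) j) [::].
have cE h j : j \in E1 -> c (run s1 (g2 ++ h)) j = c (run s1 g2) j.
  move=> jE; apply/eqP; rewrite eqn_leq c_le /= leqNgt; apply/negP => lt.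
  have := g2min (g2 ++ h); rewrite leqNgt => /negP; apply.
  rewrite (bigD1 j) //= [X in _ < X](bigD1 j) //= -addSn leq_add //.
  by apply: leq_sum => k _; exact: c_le.
(* Each of the two last letters has a full count in its own row. As a loser it would take the
   other's count in that row; since counts no longer change, both letters have full counts in both
   rows. *)
have top s0 g : s0 = run s1 (g2 ++ g) ->
  c s0 (winner true s0) = (#|~: E1|).*2 /\ c s0 (winner false s0) = (#|~: E1|).*2.
  move=> s0E; have irr0 : irreducible s0 by rewrite s0E.
  have sub0 : end_pair s0 \subset E1 by rewrite s0E.
  have aE : winner true s0 \in E1 by rewrite (fintype.subsetP sub0) ?winner_end_pair.
  have xE : winner false s0 \in E1 by rewrite (fintype.subsetP sub0) ?winner_end_pair.
  have step e j : j \in E1 -> c (rauzy e s0) j = c s0 j.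
    move=> jE; rewrite s0E (cE g) // -(cE (rcons g e)) // -cats1 catA.
    by rewrite (run_cat s1 (g2 ++ g)).
  have swapE : end_pair (swap s0) \subset E1.
    by rewrite /end_pair !winner_swap /= finset.setUC.
  have H2 : outside_before E1 (rauzy false s0).1 (winner true s0) =
            outside_before E1 s0.1 (winner false s0).
    have := outside_before_rauzy (winner true s0) (irreducible_swap irr0) swapE.
    by rewrite rauzy_swap winner_swap eqxx.
  have H1 := outside_before_rauzy (winner false s0) irr0 sub0.
  have := step false _ aE; have := step true _ xE; rewrite eqxx in H1.
  rewrite /c H1 H2 (_ : (rauzy true s0).1 = s0.1) // (_ : (rauzy false s0).2 = s0.2) //.
  have := outside_before_top aE; have := outside_before_bottom xE; lia.
(* Every letter of [E1] can still be brought to the end of a row, and its count is the same there as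
   here. *)
have full j : j \in E1 ->
  outside_before E1 (run s1 g2).1 j = #|~: E1| /\
  outside_before E1 (run s1 g2).2 j = #|~: E1|.
  move=> jE; have : j \in E (run s1 g2) by rewrite E1run.
  move=> /EP[h]; rewrite -run_cat => hj.
  have [ha hx] := top _ h erefl.
  have : c (run s1 g2) j = (#|~: E1|).*2.
    by rewrite -(cE h) //; move: hj; rewrite /end_pair !inE => /orP[]/eqP->.
  have := outside_before_le E1 (run s1 g2).1 j.
  have := outside_before_le E1 (run s1 g2).2 j; rewrite /c; lia.
apply: (irr1 g2 #|~: E1|).
  have aE := fintype.subsetP (E1end g2) _ (winner_end_pair true _).
  rewrite card_gt0; apply/andP; split.
    by apply/set0Pn; exists i; rewrite inE.
  have := cardsC E1; rewrite card_ord.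
  have : 0 < #|E1| by rewrite card_gt0; apply/set0Pn; exists (winner true (run s1 g2)).
  lia.
by rewrite !pos_outside // => j /full[].
Qed.

(** A path to [i] is cut at its first exit from [A]. Before it only letters of [A] compete; when
    these have comparable heights, every move of the path has a definite probability. *)
Lemma reach_outside s (A : {set 'I_n.+1}) i : irreducible s -> i \notin A ->
  exists g, ~~ (end_pair (run s g) \subset A) /\
    (forall g1 e g2, g = g1 ++ e :: g2 -> end_pair (run s g1) \subset A).
Proof.
move=> irrs iA; have [g] := reach_letter i irrs.
elim: g s irrs => [|e g IH] s irrs /= hi.
  exists [::]; split; last by case.
  by apply/negP => /fintype.subsetP/(_ _ hi); rewrite (negbTE iA).
have [sA|sA] := boolP (end_pair s \subset A); last by exists [::]; split=> //; case.
have [h [h1 h2]] := IH _ (irreducible_rauzy irrs) hi.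
exists (e :: h); split => //= -[|e1 g1] e2 g2 //= [<- hE].
exact: h2 hE.
Qed.

(* The winner stays in the end pair, so that [A] cannot be left without
   passing through a mixed pair. *)
Lemma reach_mixed s (A : {set 'I_n.+1}) i j : irreducible s -> i \in A -> j \notin A ->
  exists g e, winner e (run s g) \in A /\ winner (~~ e) (run s g) \notin A.
Proof.
move=> irrs iA jA; have [g0 hi] := reach_letter i irrs.
have : exists2 k, k \in end_pair (run s g0) & k \in A by exists i.
have [g hj] := reach_letter j (@irreducible_run _ g0 irrs).
elim: g g0 {hi} hj => [|e g IH] g0 /= hj [k].
  move: hj; rewrite /end_pair !inE => hj hk kA; exists g0.
  have [tA|tA] := boolP (winner true (run s g0) \in A).
    exists true; split => //=; case/orP: hj => /eqP jE; last by rewrite -jE.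
    by move: jA; rewrite jE tA.
  exists false; split => //=; case/orP: hk => /eqP kE; last by rewrite -kE.
  by move: kA; rewrite kE (negbTE tA).
rewrite (end_pairE e) !inE => hk kA.
have [?|wA] := boolP (winner e (run s g0) \in A);
  have [?|lA] := boolP (winner (~~ e) (run s g0) \in A).
- apply: (IH (rcons g0 e)); rewrite -cats1 run_cat //=.
  by exists (winner e (run s g0)); rewrite // -winner_stays winner_end_pair.
- by exists g0, e.
- by exists g0, (~~ e); rewrite negbK.
- by case/orP: hk => /eqP kE; move: wA lA; rewrite -kE kA.
Qed.

End Rauzy.

Local Open Scope ring_scope.

(** * The tree of Rauzy cones *)

Section nodes.
Variables (R : realFieldType) (n : nat).
Hypothesis n_gt0 : (0 < n)%N.
Implicit Types (s : state n) (C : 'M[R]_n.+1) (l y : 'rV[R]_n.+1) (g : seq bool).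

Definition row_step e s C : 'M[R]_n.+1 :=
  (1%:M + delta_mx (winner (~~ e) s) (winner e s)) *m C.

Definition vec_step e s l : 'rV[R]_n.+1 :=
  l *m (1%:M - delta_mx (winner (~~ e) s) (winner e s)).

Lemma row_stepE e s C i j : row_step e s C i j =
  C i j + C (winner e s) j *+ (i == winner (~~ e) s).
Proof.
rewrite /row_step mulmxDl mul1mx !mxE; congr (_ + _).
rewrite (bigD1 (winner e s)) //= big1 ?addr0 => [|k kw].
  by rewrite mxE eqxx andbT mulrC mulr_natr.
by rewrite mxE (negbTE kw) andbF mul0r.
Qed.

Lemma vec_stepE e s l i : vec_step e s l 0 i =
  l 0 i - l 0 (winner (~~ e) s) *+ (i == winner e s).
Proof.
rewrite /vec_step mulmxBr mulmx1 !mxE; congr (_ - _).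
rewrite (bigD1 (winner (~~ e) s)) //= big1 ?addr0 => [|k kw].
  by rewrite mxE eqxx /= mulr_natr.
by rewrite mxE (negbTE kw) mulr0.
Qed.

Lemma vec_stepK e s l C : irreducible s ->
  vec_step e s l *m row_step e s C = l *m C.
Proof.
move=> irrs; rewrite /vec_step /row_step mulmxA -(mulmxA l).
rewrite mulmxDr mulmx1 mulmxBl mul1mx mul_delta_mx_0 ?subr0 ?subrK ?mulmx1 //.
exact: winner_neqb.
Qed.

Lemma det_row_step e s C : irreducible s -> \det (row_step e s C) = \det C.
Proof.
move=> irrs; set a := winner e s; set x := winner (~~ e) s.
have ax : a != x by exact: winner_neqb.
pose D : 'M[R]_n.+1 := \matrix_(i, j) C (if i == x then a else i) j.
rewrite (@determinant_multilinear _ _ _ C D x 1 1).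
- rewrite (@determinant_alternate _ _ D a x) ?mulr0 ?addr0 ?mul1r // => j.
  by rewrite !mxE eqxx (negbTE ax).
- by apply/rowP => j; rewrite [LHS]mxE row_stepE !mxE !eqxx !mul1r mulr1n.
- apply/matrixP => i j; rewrite mxE [RHS]mxE row_stepE.
  by rewrite eq_sym (negbTE (neq_lift _ _)) addr0.
- apply/matrixP => i j; rewrite mxE [RHS]mxE row_stepE mxE.
  by rewrite eq_sym (negbTE (neq_lift _ _)) addr0.
Qed.

(* A node [(s, C)] of the Rauzy tree stands for the cone spanned by the rows of
   [C]: the vectors [y *m C], where [y >= 0] are the induced lengths. *)
Definition node := (state n * 'M[R]_n.+1)%type.
Implicit Types m : node.

Definition child e m : node := (rauzy e m.1, row_step e m.1 m.2).
Definition descend m g : node := foldl (fun m e => child e m) m g.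

(** The return time to the induced interval of the letter [i], and also the factor that normalizes
    the corresponding vertex of the cone to sum 1. *)
Definition height m i : R := \sum_j m.2 i j.
Definition weight m : R := \prod_i (height m i)^-1.

Definition wf m := [/\ irreducible m.1, forall i j, 0 <= m.2 i j,
  forall i, 1 <= height m i & \det m.2 = 1].

Lemma descend_state m g : (descend m g).1 = run m.1 g.
Proof. by elim: g m => //= e g IH m; rewrite IH. Qed.

Lemma descend_cat m g h : descend m (g ++ h) = descend (descend m g) h.
Proof. exact: foldl_cat. Qed.

Lemma height_child e m i : height (child e m) i =
  height m i + height m (winner e m.1) *+ (i == winner (~~ e) m.1).
Proof.
rewrite /height /= (eq_bigr _ (fun j _ => row_stepE _ _ _ _ _)) big_split /=.
by rewrite -sumrMnl.
Qed.

Lemma child_entry_le e m i j : (forall i j, 0 <= m.2 i j) ->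
  m.2 i j <= (child e m).2 i j.
Proof. by move=> h; rewrite row_stepE lerDl mulrn_wge0. Qed.

Lemma child_ge0 e m : (forall i j, 0 <= m.2 i j) ->
  forall i j, 0 <= (child e m).2 i j.
Proof. by move=> h i j; apply: le_trans (child_entry_le _ _ _ h). Qed.

Lemma descend_ge0 m g : (forall i j, 0 <= m.2 i j) ->
  forall i j, 0 <= (descend m g).2 i j.
Proof. by elim: g m => //= e g IH m h; apply: IH; exact: child_ge0. Qed.

Lemma descend_entry_le m g i j : (forall i j, 0 <= m.2 i j) ->
  m.2 i j <= (descend m g).2 i j.
Proof.
elim: g m => //= e g IH m h; apply: le_trans (child_entry_le e _ _ h) (IH _ _).
exact: child_ge0.
Qed.

Lemma height_child_le e m i : wf m -> height m i <= height (child e m) i.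
Proof. by case=> _ h _ _; apply: ler_sum => j _; exact: child_entry_le. Qed.

Lemma wf_child e m : wf m -> wf (child e m).
Proof.
move=> wfm; case: (wfm) => irrm m0 m1 dm; split.
- exact: irreducible_rauzy.
- exact: child_ge0.
- by move=> i; apply: le_trans (height_child_le _ _ wfm).
- by rewrite det_row_step.
Qed.

Lemma wf_descend m g : wf m -> wf (descend m g).
Proof. by elim: g m => //= e g IH m h; apply/IH/wf_child. Qed.

Lemma wf_root s : irreducible s -> wf (s, 1%:M).
Proof.
move=> irrs; split => //= [i j|i|]; last by rewrite det1.
  by rewrite mxE; case: eqP.
rewrite /height /= (bigD1 i) //= big1 ?mxE ?eqxx ?addr0 // => j ji.
by rewrite mxE eq_sym (negbTE ji).
Qed.

Lemma height_gt0 m i : wf m -> 0 < height m i.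
Proof. by case=> _ _ h _; apply: lt_le_trans (h i). Qed.

Lemma weight_gt0 m : wf m -> 0 < weight m.
Proof. by move=> wfm; apply: prodr_gt0 => i _; rewrite invr_gt0 height_gt0. Qed.

Lemma weight_child e m : wf m -> weight (child e m) = weight m *
  (height m (winner (~~ e) m.1) /
   (height m (winner (~~ e) m.1) + height m (winner e m.1))).
Proof.
move=> wfm; set x := winner (~~ e) _; rewrite /weight (bigD1 x) //=.
rewrite [in RHS](bigD1 x) //= height_child eqxx mulr1n.
rewrite (eq_bigr (fun i => (height m i)^-1)) => [|i ix]; last first.
  by rewrite height_child (negbTE ix) addr0.
have := height_gt0 x wfm; have := height_gt0 (winner e m.1) wfm.
move=> h1 h2; field; lra.
Qed.

(** Additivity along the tree: the ratios in [weight_child] are the conditional probabilities of the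
    two moves. *)
Lemma weight_children m : wf m ->
  weight (child true m) + weight (child false m) = weight m.
Proof.
move=> wfm; rewrite !weight_child //=.
have h1 := height_gt0 (winner true m.1) wfm.
have h2 := height_gt0 (winner false m.1) wfm.
by field; lra.
Qed.

Lemma weight_childrenb e m : wf m ->
  weight (child e m) + weight (child (~~ e) m) = weight m.
Proof. by move=> /weight_children; case: e; rewrite //= addrC. Qed.

(** Entries never decrease. If column [j0] has an entry below 1, the letters whose entry in it is at
    least 1 form a proper nonempty set, containing [j0]; at a mixed pair such a letter beats one
    outside the set, whose entry then reaches 1. The number of small entries drops. *)
Lemma positive_path s : irreducible s ->
  exists g, forall i j, 1 <= (descend (s, 1%:M) g).2 i j.
Proof.
move=> irrs.
suff H (m : node) : irreducible m.1 -> (forall i j, 0 <= m.2 i j) ->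
    (forall i, 1 <= m.2 i i) -> exists g, forall i j, 1 <= (descend m g).2 i j.
  by apply: H => // [i j|i]; rewrite /= mxE ?eqxx //; case: eqP.
have [N] := ubnP #|[set ij | m.2 ij.1 ij.2 < 1]|.
elim: N m => // N IH m; rewrite ltnS => leN irrm m0 md.
have [E|/set0Pn[[i0 j0]]] := eqVneq [set ij | m.2 ij.1 ij.2 < 1] finset.set0.
  exists [::] => i j /=; rewrite leNgt; apply/negP => ij.
  by move/setP: E => /(_ (i, j)); rewrite !inE /= ij.
rewrite inE /= => ij0.
have := @reach_mixed _ n_gt0 m.1 [set i | 1 <= m.2 i j0] j0 i0 irrm.
rewrite !inE md -ltNge => /(_ isT ij0) [g [e []]].
rewrite !inE -ltNge => hw hx.
set m' := descend m (rcons g e).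
have m'_le i j : m.2 i j <= m'.2 i j by exact: descend_entry_le.
have [|||i|h hh] := IH m'.
- apply: leq_trans leN; apply: proper_card; apply/properP; split.
    by apply/fintype.subsetP => ij; rewrite !inE; apply: le_lt_trans.
  exists (winner (~~ e) (run m.1 g), j0); rewrite !inE //= -leNgt.
  rewrite /m' -cats1 descend_cat /= row_stepE descend_state eqxx mulr1n.
  apply: le_trans hw _; apply: le_trans (descend_entry_le g _ _ m0) _.
  by rewrite lerDr descend_ge0.
- by rewrite /m' descend_state; apply: irreducible_run.
- exact: descend_ge0.
- exact: le_trans (md i) (m'_le i i).

- by exists (rcons g e ++ h) => i j; rewrite descend_cat.
Qed.

End nodes.

(** * Bad vectors of a cone and their covers by finitely many nodes *)

Section covers.
Local Open Scope classical_set_scope.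
Variables (R : realFieldType) (n : nat).
Hypothesis n_gt0 : (0 < n)%N.
Implicit Types (s : state n) (l y : 'rV[R]_n.+1) (g : seq bool) (m : node R n).

(* In case of a tie the top letter wins; this leaves a zero length, which is
   harmless. *)
Definition choice_of s l : bool := l 0 (winner false s) <= l 0 (winner true s).

Definition induce (sl : state n * 'rV[R]_n.+1) :=
  (rauzy (choice_of sl.1 sl.2) sl.1, vec_step (choice_of sl.1 sl.2) sl.1 sl.2).

Fixpoint follows s l g : bool :=
  if g is e :: g' then
    (choice_of s l == e) && follows (rauzy e s) (vec_step e s l) g'
  else true.

Definition nonneg l := forall i, 0 <= l 0 i.

Lemma nonneg_vec_step s l : nonneg l -> nonneg (vec_step (choice_of s l) s l).
Proof.
move=> l0 i; rewrite vec_stepE; have [->|] := eqVneq i; last by rewrite subr0.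
rewrite mulr1n subr_ge0 /choice_of.
by case: (leP (l 0 (winner false s)) (l 0 (winner true s))) => //= /ltW.
Qed.

Variables (gam : state n -> seq bool).

(** Stable under induction, which makes the bad part of a cone the union of pieces that are bad for
    the children. *)
Definition never s l :=
  forall k, ~~ follows (iter k induce (s, l)).1 (iter k induce (s, l)).2
                       (gam (iter k induce (s, l)).1).

Lemma never_step s l : never s l ->
  never (rauzy (choice_of s l) s) (vec_step (choice_of s l) s l).
Proof. by move=> h k; have := h k.+1; rewrite iterSr. Qed.

Definition bad m : set 'rV[R]_n.+1 :=
  [set y *m m.2 | y in [set y | nonneg y /\ never m.1 y]].

Definition bad_off m g : set 'rV[R]_n.+1 :=
  [set y *m m.2 | y in
    [set y | [/\ nonneg y, never m.1 y & ~~ follows m.1 y g]]].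

Lemma bad_child m v : irreducible m.1 -> bad m v -> exists e, bad (child e m) v.
Proof.
move=> irrm [y [y0 ny] <-]; exists (choice_of m.1 y).
exists (vec_step (choice_of m.1 y) m.1 y); last by rewrite vec_stepK.
by split; [exact: nonneg_vec_step|exact: never_step].
Qed.

Lemma bad_off_gam m : bad m `<=` bad_off m (gam m.1).
Proof. by move=> _ [y [y0 ny] <-]; exists y => //; split => //; exact: (ny 0). Qed.

Lemma bad_off_cons e m g v : irreducible m.1 -> bad_off m (e :: g) v ->
  bad (child (~~ e) m) v \/ bad_off (child e m) g v.
Proof.
move=> irrm [y [y0 ny nf] <-].
have v0 := nonneg_vec_step m.1 y0; have nv := never_step ny.
move: nf v0 nv; rewrite /=; have [-> /= nf v0 nv|eN _ v0 nv] := eqVneq (choice_of m.1 y) e.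
  by right; exists (vec_step e m.1 y); rewrite ?vec_stepK //; split.
have eE : choice_of m.1 y = ~~ e by move: eN; case: choice_of; case: e.
by left; exists (vec_step (~~ e) m.1 y); rewrite ?vec_stepK // -eE.
Qed.

Lemma bad_split m g v : irreducible m.1 -> bad m v ->
  bad_off m g v \/ bad (descend m g) v.
Proof.
move=> irrm [y [y0 ny] <-].
have [f|nf] := boolP (follows m.1 y g); last by left; exists y.
right; elim: g m irrm y y0 ny f => [|e g IH] m irrm y y0 ny; first by exists y.
have v0 := nonneg_vec_step m.1 y0; have nv := never_step ny.
move=> /= /andP[/eqP eE]; rewrite eE in v0 nv => fg.
rewrite -(vec_stepK n_gt0 e y m.2 irrm); apply: (IH (child e m)) => //.
exact: irreducible_rauzy.
Qed.

(** A stopping time in finite form: [w] bounds the probability of not having met a good step, while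
    [M] keeps the single weights from being too small, as the later gain in the exponent
    requires. *)
Definition coverable (A : set 'rV[R]_n.+1) (w M : R) :=
  exists L : seq (node R n),
    [/\ forall v, A v -> exists2 m, m \in L & bad m v,
        forall m, m \in L -> wf m /\ forall i, height m i <= M
      & \sum_(m <- L) weight m <= w].

Lemma coverable_sub A A' w w' M M' : A `<=` A' -> w' <= w -> M' <= M ->
  coverable A' w' M' -> coverable A w M.
Proof.
move=> AA ww MM [L [h1 h2 h3]]; exists L; split.
- by move=> v /AA /h1.
- by move=> m /h2 [? h]; split => // i; apply: le_trans MM.
- exact: le_trans ww.
Qed.

Lemma coverable_setU A1 A2 w1 w2 M :
  coverable A1 w1 M -> coverable A2 w2 M -> coverable (A1 `|` A2) (w1 + w2) M.
Proof.
move=> [L1 [h1 h2 h3]] [L2 [k1 k2 k3]]; exists (L1 ++ L2); split.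
- move=> v [/h1|/k1] [m mL mv]; exists m => //; rewrite mem_cat mL ?orbT //.
- by move=> m; rewrite mem_cat => /orP[/h2|/k2].
- by rewrite big_cat lerD.
Qed.

Lemma coverable_leaf m M : wf m -> (forall i, height m i <= M) ->
  coverable (bad m) (weight m) M.
Proof.
move=> wfm mM; exists [:: m]; split.
- by move=> v mv; exists m; rewrite ?mem_head.
- by move=> m'; rewrite inE => /eqP->.
- by rewrite big_seq1.
Qed.

Lemma coverable_node m w1 w2 w M : irreducible m.1 ->
  coverable (bad (child true m)) w1 M -> coverable (bad (child false m)) w2 M ->
  w1 + w2 <= w -> coverable (bad m) w M.
Proof.
move=> irrm h1 h2 ww; apply: coverable_sub ww (lexx M) (coverable_setU h1 h2).
by move=> v /(bad_child irrm) [[]]; [left|right].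
Qed.

Lemma height_child_le2 e m M i : wf m -> (forall i, height m i <= M) ->
  height (child e m) i <= 2 * M.
Proof.
move=> wfm mM; rewrite height_child.
have := mM i; have := mM (winner e m.1); have := height_gt0 (winner e m.1) wfm.
by case: eqP => _; rewrite ?mulr1n ?mulr0n; lra.
Qed.

(** A loser of height at least [M / r] against a winner of height at most [M] leaves the winner a
    proportion at least [1 / (2 * r)] of the weight. Only the letters competing along [g] need to be
    large, and their heights are measured at the start. *)
Lemma follow_path (k : nat) (r : R) : 0 < r -> exists c, [/\ 0 < c, c <= 1 &
  forall g m M, (size g <= k)%N -> wf m -> (forall i, height m i <= M) ->
    (forall g1 e g2, g = g1 ++ e :: g2 ->
      forall i, i \in end_pair (run m.1 g1) -> M / r <= height m i) ->
    [/\ c * weight m <= weight (descend m g),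
      forall i, height (descend m g) i <= 2 ^+ k * M
    & coverable (bad_off m g) (weight m - weight (descend m g)) (2 ^+ k * M)]].
Proof.
elim: k r => [|k IH] r r0.
  exists 1; split => // g m M; rewrite leqn0 size_eq0 => /eqP-> wfm mM _ /=.
  rewrite expr0 !mul1r subrr; split => //; exists [::]; split => //.
    by move=> v [y []].
  by rewrite big_nil.
(* One move at most doubles the heights, so the ratio to the new bound [2 * M] is [2 * r]. The
   minimum with 1 below also serves the empty path. *)
have [|c [c0 c1 H]] := IH (2 * r); first by rewrite mulr_gt0.
exists (Num.min 1 (c / (2 * r))); split.
- by rewrite lt_min ltr01 divr_gt0 ?mulr_gt0.
- by rewrite ge_min lexx.
move=> [|e g] m M /= sg wfm mM hend.
  have M1 : M <= 2 ^+ k.+1 * M.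
    rewrite ler_peMl ?exprn_ege1 ?ler1n //.
    exact: le_trans (ltW (height_gt0 ord0 wfm)) (mM ord0).
  split.
  - by rewrite ler_piMl ?ge_min ?lexx // ltW // weight_gt0.
  - by move=> i; apply: le_trans M1.
  - rewrite subrr; exists [::]; split => //; last by rewrite big_nil.
    by move=> v [y []].
have wfe := wf_child n_gt0 e wfm.
have [i|g1 e1 g2 gE i ii|h1 h2 h3] := H g (child e m) (2 * M) sg wfe.
- exact: height_child_le2.
- have := hend (e :: g1) e1 g2; rewrite gE => /(_ erefl i ii) h.
  rewrite -mulf_div divff ?mul1r; last by rewrite pnatr_eq0.
  exact: le_trans h (height_child_le e i wfm).
rewrite exprSr -mulrA; split => //.
- apply: le_trans h1; rewrite -/(descend _ _).
  apply: (@le_trans _ _ (c * (weight m / (2 * r)))).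
    rewrite mulrCA mulrC ler_wpM2l ?(ltW (weight_gt0 wfm)) //.
    by rewrite ge_min lexx orbT.
  rewrite ler_pM2l // weight_child // ler_pM2l ?weight_gt0 //.
  set x := winner (~~ e) _; set a := winner e _.
  have hx : M / r <= height m x.
    by apply: (hend [::] e g); rewrite // winner_end_pair.
  have x0 := height_gt0 x wfm; have a0 := height_gt0 a wfm.
  rewrite ler_pdivlMr ?addr_gt0 // mulrC ler_pdivrMr ?mulr_gt0 //.
  have := mM x; have := mM a; rewrite ler_pdivrMr // in hx.
  move: hx; lra.
- apply: (@coverable_sub _ (bad (child (~~ e) m) `|` bad_off (child e m) g) _
    (weight (child (~~ e) m) + (weight (child e m) - weight (descend (child e m) g)))
    _ (2 ^+ k * (2 * M))) => //.
  + by move=> v; apply: bad_off_cons; case: wfm.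
  + by rewrite -(weight_childrenb e wfm) addrCA addrA.
  apply: coverable_setU => //.
  apply: coverable_sub (coverable_leaf (wf_child n_gt0 (~~ e) wfm)
    (fun i => height_child_le2 (~~ e) i wfm mM)) => //.
  rewrite ler_peMl ?exprn_ege1 ?ler1n //.
  have := height_gt0 ord0 wfm; have := mM ord0; lra.
Qed.

End covers.

(** * Exponential decay of the weight of the bad cones *)

Lemma fin_uniform_bound (T : finType) (P : T -> nat -> Prop) :
  (forall x, exists k, P x k) -> exists K, forall x, exists2 k, (k <= K)%N & P x k.
Proof.
move=> /choice[f Pf]; exists (\max_x f x)%N => x; exists (f x) => //.
exact: leq_bigmax.
Qed.

Section recurrence.
Local Open Scope classical_set_scope.
Variables (R : realType) (n : nat).
Hypothesis n_gt0 : (0 < n)%N.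
Implicit Types (s : state n) (l y : 'rV[R]_n.+1) (g : seq bool) (m : node R n).
Variables (gam : state n -> seq bool).

Local Notation bad := (@bad R n gam).
Local Notation coverable := (@coverable R n gam).

(** * Waiting for a small letter to become large *)

Section supermartingale.
Variables (A : {set 'I_n.+1}) (theta M M' kap : R) (c : 'I_n.+1 -> R).
Hypothesis kap1 : kap <= 1.
Hypothesis MM' : M <= M'.
Hypothesis theta_gt0 : 0 < theta.
Hypothesis theta_le : theta + theta <= M.
Hypothesis c_gt0 : forall i, i \in A -> 0 < c i.
Hypothesis c_le : forall i, i \in A -> theta + c i <= M.
Hypothesis success : forall m i, wf m -> (forall i, height m i <= M) ->
  (forall j, j \in A -> theta <= height m j) ->
  i \notin A -> theta <= height m i ->
  coverable (bad m) (kap * weight m) M'.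

Definition large_part m : R := \sum_(j in A) height m j / c j.

(** It dominates the cost of every way of stopping: a factor [kap] once a letter outside [A] has
    height at least [theta], and a factor 1 once some [j] in [A] exceeds [c j], where [large_part]
    is at least 1. *)
Definition potential m : R := weight m * (kap + (1 - kap) * large_part m).

Lemma large_part_ge0 m : wf m -> 0 <= large_part m.
Proof.
move=> wfm; apply: sumr_ge0 => j jA.
by rewrite divr_ge0 ?ltW ?height_gt0 ?c_gt0.
Qed.

Lemma large_part_child e m : large_part (child e m) = large_part m +
  (if winner (~~ e) m.1 \in A
   then height m (winner e m.1) / c (winner (~~ e) m.1) else 0).
Proof.
rewrite /large_part; set x := winner (~~ e) _; case: ifPn => xA; last first.
  rewrite addr0; apply: eq_bigr => j jA; rewrite height_child.
  by case: eqP => [E|_]; rewrite ?addr0 //; move: xA; rewrite /x -E jA.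
rewrite (bigD1 x) //= [in RHS](bigD1 x) //= height_child eqxx mulr1n mulrDl.
rewrite -!addrA; congr (_ + _); rewrite addrC; congr (_ + _).
by apply: eq_bigr => j /andP[_ jx]; rewrite height_child (negbTE jx) addr0.
Qed.

Lemma weight_le_potential m j : wf m -> j \in A -> c j <= height m j ->
  weight m <= potential m.
Proof.
move=> wfm jA cj; rewrite ler_peMr ?(ltW (weight_gt0 wfm)) //.
have : 1 <= large_part m.
  rewrite /large_part (bigD1 j) //= ler_wpDr ?ler_pdivlMr ?mul1r ?c_gt0 //.
  by apply: sumr_ge0 => i /andP[iA _]; rewrite divr_ge0 ?ltW ?height_gt0 ?c_gt0.
move: kap1; nra.
Qed.

(** When a letter of [A] beats a letter outside [A], the loser's height passes [theta] at once and
    the waiting ends in success; otherwise it goes on. *)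
Definition child_bound e m :=
  if winner e m.1 \in A then kap * weight (child e m) else potential (child e m).

(* When the large letter [winner e] meets the small letter [winner (~~ e)], the
   weight of the branch in which the large one loses is inversely proportional
   to its new height, so that its contribution to [large_part] is preserved. *)
Lemma child_bound_sum m : wf m -> ~~ (end_pair m.1 \subset A) ->
  child_bound true m + child_bound false m <= potential m.
Proof.
move=> wfm; have w0 := weight_gt0 wfm; have T0 := large_part_ge0 wfm.
have one e : winner e m.1 \in A -> winner (~~ e) m.1 \notin A ->
    child_bound e m + child_bound (~~ e) m <= potential m.
  move=> aA xA; rewrite /child_bound aA (negbTE xA) /potential.
  rewrite large_part_child negbK aA -(weight_childrenb e wfm).
  set a := winner e m.1; set x := winner (~~ e) m.1.
  have ha := height_gt0 a wfm; have hx := height_gt0 x wfm.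
  have ca := c_gt0 aA.
  suff : weight (child (~~ e) m) * (large_part m + height m x / c a) <=
         weight m * large_part m.
    rewrite -(weight_childrenb e wfm).
    move: kap1; set W1 := weight (child e m); set W2 := weight (child (~~ e) m).
    set T := large_part m; set T' := T + _ => k1 hle.
    have : (1 - kap) * (W2 * T') <= (1 - kap) * ((W1 + W2) * T).
      by rewrite ler_wpM2l // subr_ge0.
    lra.
  have le : height m a / c a <= large_part m.
    rewrite /large_part (bigD1 a) //= lerDl sumr_ge0 // => i /andP[iA _].
    by rewrite divr_ge0 ?ltW ?height_gt0 ?c_gt0.
  rewrite weight_child // negbK -/a -/x -mulrA ler_wpM2l ?(ltW w0) //.
  rewrite mulrAC ler_pdivrMr ?addr_gt0 // mulrDr [leRHS]mulrDr.
  rewrite [height m a * large_part m]mulrC lerD2l.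
  have -> : height m a * (height m x / c a) = (height m a / c a) * height m x.
    by rewrite mulrAC -mulrA mulrC; ring.
  by rewrite ler_wpM2r // ltW.
move=> pA.
have [aA|aA] := boolP (winner true m.1 \in A);
  have [xA|xA] := boolP (winner false m.1 \in A).
- case/negP: pA; apply/fintype.subsetP => i.
  by rewrite /end_pair !inE => /orP[]/eqP->.
- exact: (one true).
- by rewrite addrC; apply: (one false).
- rewrite /child_bound (negbTE aA) (negbTE xA) /potential.
  rewrite !large_part_child /= (negbTE aA) (negbTE xA) !addr0 -mulrDl.
  by rewrite weight_children.
Qed.

Lemma success_le_potential m : wf m -> kap * weight m <= potential m.
Proof.
move=> wfm; rewrite mulrC ler_wpM2l ?(ltW (weight_gt0 wfm)) //.
by rewrite lerDl mulr_ge0 ?subr_ge0 ?large_part_ge0.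
Qed.

(** The waiting ends because each move adds at least 1 to the sum of the heights, which stays below
    [M * n.+1]; [N] counts what is left. *)
Lemma coverable_potential m : wf m -> ~~ (end_pair m.1 \subset A) ->
  (forall j, j \in A -> theta <= height m j <= c j) ->
  (forall i, i \notin A -> height m i < theta) ->
  coverable (bad m) (potential m) M'.
Proof.
move=> wfm.
have [N] : exists N : nat, M * n.+1%:R < \sum_i height m i + N%:R.
  exists (Num.truncn (M * n.+1%:R)).+1.
  apply: (@lt_le_trans _ _ (Num.truncn (M * n.+1%:R)).+1%:R).
    exact: truncnS_gt.
  by rewrite lerDr sumr_ge0 // => i _; apply/ltW/height_gt0.
elim: N m wfm => [|N IH] m wfm hN pA largeA smallA.
  have hM i : height m i <= M.
    have [iA|iA] := boolP (i \in A).
      have /andP[_ h] := largeA i iA; have := c_le iA; have := theta_gt0; lra.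
    have := smallA i iA; have := theta_le; have := theta_gt0; lra.
  have : \sum_i height m i <= \sum_(i < n.+1) M by apply: ler_sum => i _.
  by rewrite sumr_const card_ord -mulr_natr leNgt; rewrite addr0 in hN; rewrite hN.
have irrm : irreducible m.1 by case: wfm.
have wfc e := wf_child n_gt0 e wfm.
have sub e : coverable (bad (child e m)) (child_bound e m) M'.
  set w := winner e m.1; set x := winner (~~ e) m.1.
  have wx : (w \notin A) || (x \notin A).
    rewrite -negb_and; apply: contra pA => /andP[wA xA].
    by apply/fintype.subsetP => i; rewrite (end_pairE e) !inE => /orP[]/eqP->.
  have hc i : height (child e m) i = height m i + height m w *+ (i == x).
    exact: height_child.
  have hM i : height (child e m) i <= M.
    rewrite hc; have [->|ix] := eqVneq i x; rewrite ?mulr1n ?mulr0n ?addr0.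
      case/orP: wx => [wA|xA].
        have := smallA w wA.
        have [xA|xA] := boolP (x \in A); last by have := smallA x xA; have := theta_le; lra.
        by have /andP[_] := largeA x xA; have := c_le xA; lra.
      have := smallA x xA.
      have [wA|wA] := boolP (w \in A); last by have := smallA w wA; have := theta_le; lra.
      by have /andP[_] := largeA w wA; have := c_le wA; lra.
    have [iA|iA] := boolP (i \in A).
      have /andP[_ h] := largeA i iA; have := c_le iA; have := theta_gt0; lra.
    have := smallA i iA; have := theta_le; have := theta_gt0; lra.
  have hA j : j \in A -> theta <= height (child e m) j.
    move=> jA; apply: le_trans (height_child_le e j wfm).
    by have /andP[] := largeA j jA.
  rewrite /child_bound -/w; case: ifPn => wA.
    rewrite wA in wx; apply: (@success (child e m) x) => //.
    rewrite hc eqxx mulr1n; have /andP[+ _] := largeA w wA.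
    have := height_gt0 x wfm; lra.
  have IHe : (forall j, j \in A -> height (child e m) j <= c j) ->
      (forall i, i \notin A -> height (child e m) i < theta) ->
      coverable (bad (child e m)) (potential (child e m)) M'.
    move=> h1 h2; apply: IH => //.
    - apply: lt_le_trans hN _; rewrite (eq_bigr _ (fun i _ => hc i)) big_split /=.
      have -> : \sum_i height m w *+ (i == x) = height m w.
        by rewrite (bigD1 x) //= eqxx big1 ?addr0 // => i /negbTE->.
      by case: (wfm) => _ _ /(_ w) h _; rewrite -natr1; lra.
    (* A winner outside [A] remains last in its row, so the next pair again contains a letter
       outside [A]. *)
    - apply/negP => /fintype.subsetP/(_ w) h; case/negP: wA; apply: h.
      by rewrite /w -winner_stays; exact: winner_end_pair.
    - by move=> j jA; rewrite hA ?h1.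
  have [xA|xA] := boolP (x \in A).
    have [le|lt] := leP (height (child e m) x) (c x).
      apply: IHe => i iA.
        have [->//|ix] := eqVneq i x.
        by rewrite hc (negbTE ix) addr0; case/andP: (largeA i iA).
      rewrite hc; case: eqP iA => [->|_]; first by rewrite xA.
      by rewrite addr0; exact: smallA.
    (* Stopped as a failure: the potential already pays for the whole weight. *)
    exact: coverable_sub (@subset_refl _ _) (weight_le_potential (wfc e) xA (ltW lt))
      MM' (coverable_leaf gam (wfc e) hM).
  have [le|lt] := leP theta (height (child e m) x).
    apply: coverable_sub (@subset_refl _ _) (success_le_potential (wfc e)) (lexx M') _.
    exact: (@success (child e m) x).
  apply: IHe => i iA.
    rewrite hc; case: eqP iA => [->|_]; first by rewrite (negbTE xA).
    by move=> iA; rewrite addr0; case/andP: (largeA i iA).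
  have [->//|ix] := eqVneq i x; rewrite hc (negbTE ix) addr0; exact: smallA.
exact: (coverable_node n_gt0 irrm (sub true) (sub false) (child_bound_sum wfm pA)).
Qed.

End supermartingale.
Lemma reach_outside_bounded : exists K : nat, forall s (A : {set 'I_n.+1}) i,
  irreducible s -> i \notin A ->
  exists g, [/\ (size g <= K)%N, ~~ (end_pair (run s g) \subset A) &
    forall g1 e g2, g = g1 ++ e :: g2 -> end_pair (run s g1) \subset A].
Proof.
pose P (x : state n * {set 'I_n.+1}) k := forall i, irreducible x.1 -> i \notin x.2 ->
  exists g, [/\ size g = k, ~~ (end_pair (run x.1 g) \subset x.2) &
    forall g1 e g2, g = g1 ++ e :: g2 -> end_pair (run x.1 g1) \subset x.2].
have [[s A]|K HK] := @fin_uniform_bound _ P.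
  have [[irrs [i iA]]|h] := pselect (irreducible s /\ exists i, i \notin A).
    have [g [g1 g2]] := reach_outside n_gt0 irrs iA.
    by exists (size g) => j _ _; exists g.
  by exists 0 => i irrs iA; exfalso; apply: h; split => //; exists i.
exists K => s A i irrs iA; have [k kK /(_ i irrs iA) [g [gk g1 g2]]] := HK (s, A).
by exists g; rewrite gk; split.
Qed.

Definition large_letters m (t : R) : {set 'I_n.+1} := [set i | t <= height m i]%SET.

(** Loss of a definite proportion of the weight from nodes with at least [k] letters of height
    comparable to [M]. Every ratio [r] is allowed because passing from [k.+1] to [k] calls it with a
    larger one. *)
Definition recurrent k := forall r : R, 1 <= r -> exists kap K,
  [/\ 0 <= kap, kap < 1, 1 <= K &
    forall m M, wf m -> (forall i, height m i <= M) ->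
      (k <= #|large_letters m (M / r)%R|)%N ->
      coverable (bad m) (kap * weight m) (K * M)].

(** With all heights comparable, the good path itself can be followed with definite probability. *)
Lemma recurrent_full : recurrent n.+1.
Proof.
move=> r r1; have r0 := lt_le_trans ltr01 r1.
have [c [c0 c1 H]] := @follow_path R n n_gt0 gam (\max_s size (gam s))%N r r0.
exists (1 - c), (2 ^+ (\max_s size (gam s))%N); split; rewrite ?exprn_ege1 ?ler1n //.
- by rewrite subr_ge0.
- by rewrite ltrBlDr ltrDl.
move=> m M wfm mM; rewrite -{1}(card_ord n.+1) => full.
have all i : M / r <= height m i.
  have /eqP/setP/(_ i) : large_letters m (M / r) == [set: 'I_n.+1]%SET.
    by rewrite finset.eqEcard finset.subsetT cardsT.
  by rewrite !inE.
have [||h1 h2 h3] := H (gam m.1) m M _ wfm mM.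
- exact: (leq_bigmax (F := fun s => size (gam s))).
- by move=> g1 e g2 _ i _.
apply: coverable_sub (@bad_off_gam _ _ _ _) _ (lexx _) h3.
by rewrite mulrBl mul1r lerD2l lerN2.
Qed.

(** With exactly [k] large letters, a bounded path [g] first leads out of [A], the set of these
    letters. From there the supermartingale runs until another letter reaches the threshold [theta],
    where [recurrent k.+1] takes over. *)
Lemma recurrent_pred k : (k <= n)%N -> recurrent k.+1 -> recurrent k.
Proof.
move=> kn rec r r1; have r0 := lt_le_trans ltr01 r1.
have [l Hl] := reach_outside_bounded.
have [c [c0 c1 Hf]] := @follow_path R n n_gt0 gam l r r0.
have [kap1 [K1 [kap10 kap11 K11 H1]]] := rec r r1.
(* Letting the large heights grow by a factor [D] makes [large_part] start at [k / D], which is at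
   most one half. *)
pose D : R := 2 * n.+1%:R.
have D2 : 2 <= D by rewrite /D ler_peMr // ler1n.
have p1 : 1 <= 2 ^+ l :> R by rewrite exprn_ege1 ?ler1n.
(* While waiting, the heights stay below [(D + 1) * 2 ^+ l * M], the factor [2 ^+ l] coming from
   [g]; the threshold [M / r] is this bound divided by [r2]. *)
pose r2 := (D + 1) * 2 ^+ l * r.
have r21 : 1 <= r2 by do 2?apply: mulr_ege1 => //; lra.
have [kap2 [K2 [kap20 kap21 K21 H2]]] := rec r2 r21.
(* A proportion at least [c] of the weight follows [g], and of that a proportion [(1 - kap2) / 2] is
   lost. *)
pose kap' := 1 - (1 - kap2) / 2 * c.
have kap'1 : kap' < 1 by rewrite /kap'; nra.
exists (Num.max kap1 kap'), (Num.max K1 (K2 * ((D + 1) * 2 ^+ l))); split.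
- by rewrite le_max kap10.
- by rewrite gt_max kap11.
- by rewrite le_max K11.
move=> m M wfm mM; set A := large_letters m (M / r) => kA.
have M1 : 1 <= M by case: (wfm) => _ _ /(_ ord0) h _; exact: le_trans h (mM ord0).
have w0 := weight_gt0 wfm.
have [kA1|kA1] := leqP k.+1 #|A|.
  apply: coverable_sub (@subset_refl _ _) _ _ (H1 m M wfm mM kA1).
    by rewrite ler_wpM2r ?(ltW w0) // le_max lexx.
  by rewrite ler_wpM2r ?le_max ?lexx // (le_trans ler01).
have {kA kA1} Ak : #|A| = k by apply/eqP; rewrite eqn_leq -ltnS kA1.
have /set0Pn[i0] : ~: A != finset.set0.
  rewrite -card_gt0 lt0n; apply/negP => /eqP h0.
  by have := cardsC A; rewrite card_ord Ak h0 addn0 => ke; rewrite ke ltnn in kn.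
rewrite inE => i0A.
have [irrm _ _ _] := wfm.
have [g [gl gA gsub]] := Hl m.1 A i0 irrm i0A.
have [|cw hM' cov] := Hf g m M gl wfm mM.
  move=> g1 e g2 gE i /(fintype.subsetP (gsub g1 e g2 gE)); by rewrite inE.
set m' := descend m g in cw hM' cov.
have wfm' : wf m' by exact: wf_descend.
have w0' := weight_gt0 wfm'.
set theta := M / r.
have theta0 : 0 < theta by rewrite divr_gt0 // (lt_le_trans ltr01).
have thetaM : theta <= M by rewrite ler_pdivrMr // ler_peMr // (le_trans ler01).
pose M' := 2 ^+ l * M; pose M2 := (D + 1) * M'.
have MM' : M <= M' by rewrite ler_peMl // (le_trans ler01).
have M2r : M2 / r2 = theta.
  rewrite /M2 /r2 /theta /M'; field; rewrite !gt_eqF ?exprn_gt0 //.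
  by move: D2; lra.
have largeA i : i \in A -> theta <= height m' i.
  rewrite inE => /le_trans; apply.
  by apply: ler_sum => j _; apply: descend_entry_le; case: wfm.
have succ m0 i : wf m0 -> (forall i, height m0 i <= M2) ->
    (forall j, j \in A -> theta <= height m0 j) ->
    i \notin A -> theta <= height m0 i ->
    coverable (bad m0) (kap2 * weight m0) (K2 * M2).
  move=> wfm0 h1 h2 iA hi; apply: H2 => //; rewrite M2r.
  have <- : #|i |: A| = k.+1 by rewrite cardsU1 iA Ak.
  apply: subset_leq_card; apply/fintype.subsetP => j; rewrite !inE.
  by case/orP => [/eqP->//|jA]; apply: h2; rewrite inE.
(* The factor is [kap2 + (1 - kap2) * 2^-1], the potential with [large_part] at most one half. *)
have main : coverable (bad m') ((1 + kap2) / 2 * weight m') (K2 * M2).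
  have [/existsP[i /andP[iA hi]]|none] :=
      boolP [exists i, (i \notin A) && (theta <= height m' i)].
    apply: coverable_sub (@subset_refl _ _) _ (lexx _) (succ m' i wfm' _ largeA iA hi).
      by rewrite ler_wpM2r ?(ltW w0') // -subr_ge0; move: kap21; lra.
    move=> j; apply: le_trans (hM' j) _; rewrite -/M' /M2 ler_peMl //.
      by rewrite (le_trans _ MM') // (le_trans ler01).
    by move: D2; lra.
  have smallA i : i \notin A -> height m' i < theta.
    move=> iA; rewrite ltNge; apply: contra none => hi.
    by apply/existsP; exists i; rewrite iA.
  pose c' i := D * height m' i.
  have c'0 i : i \in A -> 0 < c' i.
    by move=> _; rewrite mulr_gt0 ?height_gt0 // (lt_le_trans _ D2).
  have lp : large_part A c' m' <= 2^-1.
    rewrite /large_part (eq_bigr (fun=> D^-1)) => [|i _].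
      rewrite sumr_const Ak -[_ *+ k]mulr_natr /D invfM -mulrA ler_piMr ?invr_ge0 //.
      by rewrite mulrC ler_pdivrMr ?ltr0n // mul1r ler_nat ltnW.
    have := height_gt0 i wfm'; rewrite /c' => h.
    by rewrite invfM mulrA mulrAC mulfV ?mul1r // gt_eqF.
  have M'0 : 0 < M' by rewrite (lt_le_trans _ MM') // (lt_le_trans ltr01).
  have DM : 2 * M' <= D * M' by rewrite ler_wpM2r // ltW.
  have M2D : M2 = D * M' + M' by rewrite /M2 mulrDl mul1r.
  have tM' : theta <= M' by exact: le_trans MM'.
  have M2K : M2 <= K2 * M2.
    by rewrite ler_peMl // M2D addr_ge0 ?(ltW M'0) // mulr_ge0 ?(ltW M'0) ?(le_trans _ D2).
  have th2 : theta + theta <= M2 by rewrite M2D; lra.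
  have thc i : i \in A -> theta + c' i <= M2.
    by move=> _; rewrite M2D addrC lerD // ler_wpM2l ?hM' // (le_trans _ D2).
  have gA' : ~~ (end_pair m'.1 \subset A) by rewrite /m' descend_state.
  have thA j : j \in A -> theta <= height m' j <= c' j.
    move=> jA; rewrite largeA // ler_peMl ?(ltW (height_gt0 j wfm')) //.
    by rewrite (le_trans _ D2) // ler1n.
  have := coverable_potential (ltW kap21) M2K theta0 th2 c'0 thc succ wfm' gA'
    thA smallA.
  apply: coverable_sub (@subset_refl _ _) _ (lexx _).
  rewrite /potential mulrC ler_wpM2r ?(ltW w0') //.
  have : (1 - kap2) * large_part A c' m' <= (1 - kap2) * 2^-1.
    by rewrite ler_wpM2l // subr_ge0 ltW.
  lra.
apply: (@coverable_sub _ _ _ _ (bad_off gam m g `|` bad m') _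
  (weight m - weight m' + (1 + kap2) / 2 * weight m') _ (K2 * M2)).
- by move=> v /(bad_split n_gt0 g irrm).
- have h : kap' * weight m <= Num.max kap1 kap' * weight m.
    by rewrite ler_wpM2r ?(ltW w0) // le_max lexx orbT.
  apply: le_trans h; rewrite /kap'.
  have : (1 - kap2) / 2 * (c * weight m) <= (1 - kap2) / 2 * weight m'.
    by rewrite ler_wpM2l // divr_ge0 // subr_ge0 ltW.
  by lra.
- have -> : K2 * M2 = K2 * ((D + 1) * 2 ^+ l) * M by rewrite /M2 /M' !mulrA.
  by rewrite ler_wpM2r ?le_max ?lexx ?orbT // (le_trans ler01).
apply: coverable_setU => //.
apply: coverable_sub (@subset_refl _ _) (lexx _) _ cov.
rewrite -/M' /M2.
have M'0 : 0 <= M' by rewrite (le_trans _ MM') // (le_trans ler01).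
rewrite mulrA ler_peMl // mulr_ege1 //; lra.

Qed.

Lemma recurrent0 : recurrent 0.
Proof.
have H k : (k <= n.+1)%N -> recurrent (n.+1 - k).
  elim: k => [|k IH] kn; first by rewrite subn0; exact: recurrent_full.
  by apply: recurrent_pred; [lia|rewrite -subSn // subSS; apply: IH; lia].
by have := H n.+1 (leqnn _); rewrite subnn.
Qed.

Lemma coverable_bad : exists kap K,
  [/\ 0 <= kap, kap < 1, 1 <= K &
    forall m M, wf m -> (forall i, height m i <= M) ->
      coverable (bad m) (kap * weight m) (K * M)].
Proof.
have [kap [K [h1 h2 h3 H]]] := recurrent0 (lexx 1).
by exists kap, K; split => // m M wfm mM; exact: H.
Qed.

Lemma coverable_refine kap K A w M : 0 <= kap ->
  (forall m M, wf m -> (forall i, height m i <= M) ->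
      coverable (bad m) (kap * weight m) (K * M)) ->
  coverable A w M -> coverable A (kap * w) (K * M).
Proof.
move=> kap0 H [L [h1 h2 h3]].
have : coverable [set v | exists2 m, m \in L & bad m v]
                 (kap * \sum_(m <- L) weight m) (K * M).
  elim: L h2 {h1 h3} => [|m L IH] h2.
    exists [::]; split; rewrite ?big_nil ?mulr0 //.
  rewrite big_cons mulrDr.
  have sub : [set v | exists2 m', m' \in m :: L & bad m' v] `<=`
      bad m `|` [set v | exists2 m', m' \in L & bad m' v].
    move=> v [m']; rewrite inE => /orP[/eqP->|m'L mv]; first by left.
    by right; exists m'.
  have covm : coverable (bad m) (kap * weight m) (K * M).
    by apply: H; have [] := h2 m (mem_head _ _).
  have covL : coverable [set v | exists2 m', m' \in L & bad m' v]
      (kap * \sum_(m' <- L) weight m') (K * M).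
    by apply: IH => m' m'L; apply: h2; rewrite inE m'L orbT.
  exact: coverable_sub sub (lexx _) (lexx _) (coverable_setU covm covL).
apply: coverable_sub => //; by rewrite ler_wpM2l.
Qed.

Lemma coverable_iter : exists kap K,
  [/\ 0 <= kap, kap < 1, 1 <= K &
    forall m M, wf m -> (forall i, height m i <= M) ->
      forall j : nat, coverable (bad m) (kap ^+ j * weight m) (K ^+ j * M)].
Proof.
have [kap [K [h1 h2 h3 H]]] := coverable_bad; exists kap, K; split => // m M wfm mM.
elim=> [|j IH]; first by rewrite !expr0 !mul1r; exact: coverable_leaf.
by rewrite !exprS -!mulrA; apply: coverable_refine.
Qed.

End recurrence.

(** * Covering a simplex by small cubes *)

Section covering.
Variable R : realType.

Lemma grid (rho h : R) : 0 < rho -> 0 <= h -> exists G : seq R,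
  (size G)%:R * rho <= 2 * h + 3 * rho /\
  forall w, `|w| <= h -> exists2 t, t \in G & `|w - t| <= rho.
Proof.
move=> rho0 h0; pose K := (Num.truncn (h / rho)).+1.
exists [seq (k%:R - K%:R) * rho | k <- iota 0 (2 * K).+1].
have Kle : K%:R * rho <= h + rho.
  rewrite /K -natr1 mulrDl mul1r lerD2r -ler_pdivlMr //.
  by rewrite truncn_le divr_ge0 // ltW.
have ltK : h < K%:R * rho by rewrite -ltr_pdivrMr // /K; apply: truncnS_gt.
split.
  rewrite size_map size_iota -natr1 natrM; lra.
move=> w; rewrite ler_norml => /andP[w1 w2].
have q0 : 0 <= (w + K%:R * rho) / rho by rewrite divr_ge0 ?(ltW rho0) //; lra.
set k := Num.truncn ((w + K%:R * rho) / rho).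
have k1 : k%:R * rho <= w + K%:R * rho by rewrite -ler_pdivlMr // truncn_le.
have k2 : w + K%:R * rho < k.+1%:R * rho.
  by rewrite -ltr_pdivrMr //; exact: truncnS_gt.
exists ((k%:R - K%:R) * rho).
  apply/mapP; exists k => //; rewrite mem_iota add0n /= ltnS.
  rewrite -ltnS -(ltr_nat R) -(ltr_pM2r rho0) -[X in _ < X * _]natr1 natrM; lra.
rewrite -natr1 in k2; rewrite ler_norml; apply/andP; split; lra.
Qed.

(** For a matrix with bounded entries, a scale [rho] below the determinant is, up to a constant,
    below the thickness of the image of the cube in every direction, so the number of small cubes is
    governed by the volume. The bound on the determinant is carried for the induction. *)
Definition cube_covered n (V : 'M[R]_n) (C : R) :=
  `|\det V| <= C /\ forall rho, 0 < rho -> rho <= `|\det V| ->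
  exists S : seq 'rV[R]_n, (size S)%:R * rho ^+ n <= C * `|\det V| /\
  forall z : 'rV[R]_n, (forall i, `|z 0 i| <= 1) ->
    exists2 c, c \in S & forall i, `|(z *m V) 0 i - c 0 i| <= C * rho.

(** One step of elimination with the largest entry [u] as pivot. The first coordinate [w] of the
    image ranges over an interval of length comparable to [u] and is put on a grid; for fixed [w]
    the others are a translate of the image under the Schur complement [S]. Since [r / u] is at most
    1 in absolute value, rounding [w] is not amplified. *)
Lemma cube_covered_pivot n (b C0 : R) : 1 <= b -> 0 <= C0 ->
  (forall V : 'M[R]_n, (forall i j, `|V i j| <= 2 * b) -> cube_covered V C0) ->
  forall V : 'M[R]_(1 + n), (forall i j, `|V i j| <= b) ->
    (forall i j, `|V i j| <= `|V 0 0|) ->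
    cube_covered V (b * C0 + (1 + C0) + (2 * n.+1%:R + 3 * C0) * (C0 * b ^+ n)).
Proof.
move=> b1 C00 IH V Vb Vu; set C := (X in cube_covered _ X).
have b0 : 0 < b by exact: lt_le_trans b1.
have bn0 : 0 <= b ^+ n by rewrite exprn_ge0 // ltW.
have n0 : 0 <= n.+1%:R :> R by [].
have C3 : 0 <= (2 * n.+1%:R + 3 * C0) * (C0 * b ^+ n).
  by rewrite mulr_ge0 ?addr_ge0 ?mulr_ge0.
have bC : 0 <= b * C0 by rewrite mulr_ge0 // ltW.
have C0le : 0 <= C by rewrite /C; lra.
have [u0|u0] := eqVneq (V 0 0) 0.
  have -> : V = 0.
    by apply/matrixP => i j; have := Vu i j; rewrite u0 normr0 normr_le0 mxE => /eqP.
  rewrite /cube_covered det0 normr0; split => // rho r0 r1.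
  by move: (lt_le_trans r0 r1); rewrite ltxx.
set u := V 0 0 in u0 Vu *.
pose r := ursubmx V; pose c := dlsubmx V; pose D := drsubmx V.
have VE : V = block_mx u%:M r c D.
  rewrite -[LHS]submxK; congr block_mx; apply/matrixP => i j.
  by rewrite !ord1 !mxE /u; congr (V _ _); apply: val_inj.
pose S := D - u^-1 *: (c *m r).
have VLU : V = block_mx 1%:M 0 (u^-1 *: c) 1%:M *m block_mx u%:M r 0 S.
  rewrite mulmx_block !mul1mx !mul0mx !addr0 VE; congr block_mx.
    by rewrite mul_mx_scalar scalerA mulfV // scale1r.
  by rewrite /S -scalemxAl addrC subrK.
have detV : \det V = u * \det S.
  by rewrite VLU det_mulmx det_lblock det_ublock !det1 !mul1r det_scalar1.
have rE j : r 0 j = V 0 (rshift 1 j) by rewrite !mxE; congr (V _ _); apply: val_inj.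
have cE i : c i 0 = V (rshift 1 i) 0 by rewrite !mxE; congr (V _ _); apply: val_inj.
have ru j : `|r 0 j / u| <= 1.
  by rewrite normrM normfV ler_pdivrMr ?normr_gt0 // mul1r rE.
have Sb i j : `|S i j| <= 2 * b.
  have -> : S i j = D i j - c i 0 * (r 0 j / u).
    by rewrite !mxE big_ord1 mulrC -!mulrA; congr (_ - _ * _); rewrite !mxE.
  apply: le_trans (ler_normB _ _) _; rewrite mulr2n mulrDl mul1r lerD //.
    by rewrite !mxE.
  rewrite normrM -[leRHS]mulr1 ler_pM // cE; exact: Vb.
have [detS HS] := IH S Sb.
have uu : 0 < `|u| by rewrite normr_gt0.
have ub : `|u| <= b by exact: Vb.
split.
  rewrite detV normrM; apply: (@le_trans _ _ (b * C0)); first by rewrite ler_pM.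
  by rewrite /C; lra.
move=> rho r0 rdet.
(* Division by [b] ensures that [rho'] is at most the determinant of [S], since the pivot is at most
   [b]. *)
pose rho' := rho / b.
have r'0 : 0 < rho' by rewrite divr_gt0.
have r'r : rho' <= rho by rewrite ler_pdivrMr // ler_peMr // ltW.
have r'S : rho' <= `|\det S|.
  rewrite ler_pdivrMr // (le_trans rdet) // detV normrM mulrC ler_wpM2l //.
have [T [sT HT]] := HS rho' r'0 r'S.
have h0 : 0 <= n.+1%:R * `|u| by rewrite mulr_ge0.
have [G [sG HG]] := grid r0 h0.
exists [seq row_mx (t%:M : 'M[R]_1) (t *: (u^-1 *: r) + s) | t <- G, s <- T]; split.
  rewrite size_allpairs natrM.
  have e1 : (size T)%:R * rho ^+ n <= C0 * b ^+ n * `|\det S|.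
    have -> : rho = b * rho' by rewrite mulrCA mulfV ?mulr1 // gt_eqF.
    by rewrite exprMn mulrCA [leRHS]mulrAC [leRHS]mulrC ler_wpM2l.
  have e2 : (size G)%:R * rho <= (2 * n.+1%:R + 3 * C0) * `|u|.
    apply: le_trans sG _.
    have : rho <= `|u| * C0.
      by rewrite (le_trans rdet) // detV normrM ler_wpM2l // ltW.
    lra.
  rewrite detV normrM.
  apply: (@le_trans _ _ (((2 * n.+1%:R + 3 * C0) * `|u|) * (C0 * b ^+ n * `|\det S|))).
    have -> : (size G)%:R * (size T)%:R * rho ^+ (1 + n) =
        ((size G)%:R * rho) * ((size T)%:R * rho ^+ n) by rewrite add1n exprSr; ring.
    by rewrite ler_pM // mulr_ge0 // ?exprn_ge0 // ltW.
  have -> : (2 * n.+1%:R + 3 * C0) * `|u| * (C0 * b ^+ n * `|\det S|) =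
     (2 * n.+1%:R + 3 * C0) * (C0 * b ^+ n) * (`|u| * `|\det S|) by ring.
  rewrite ler_wpM2r ?mulr_ge0 // /C; lra.
move=> z z1.
have [z0 [z' zE]] : exists (z0 : R) z', z = row_mx (z0%:M : 'M[R]_1) z'.
  exists (lsubmx z 0 0), (rsubmx z); rewrite -mx11_scalar hsubmxK //.
pose w := z0 * u + (z' *m c) 0 0.
have zV : z *m V = row_mx (w%:M : 'M[R]_1) (w *: (u^-1 *: r) + z' *m S).
  rewrite zE VE mul_row_block; congr row_mx.
    rewrite [z' *m c]mx11_scalar -scalar_mxM -raddfD //.
  rewrite mul_scalar_mx /S mulmxBr /w scalerDl !scalerA mulfK //.
  rewrite -addrA; congr (_ + _).
  rewrite -scalemxAr mulmxA [in RHS](mx11_scalar (z' *m c)) mul_scalar_mx scalerA.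
  by rewrite [_%:M 0 0]mxE eqxx mulr1n [_ / u]mulrC addrC subrK.
have wb : `|w| <= n.+1%:R * `|u|.
  have -> : w = (z *m V) 0 0.
    have -> : (0 : 'I_(1 + n)) = lshift n (0 : 'I_1) by apply: val_inj.
    by rewrite zV row_mxEl mxE eqxx.
  rewrite mxE (le_trans (ler_norm_sum _ _ _)) //.
  apply: (@le_trans _ _ (\sum_(i < 1 + n) `|u|)); last first.
    by rewrite sumr_const card_ord -[leLHS]mulr_natl.
  by apply: ler_sum => i _; rewrite normrM -[leRHS]mul1r ler_pM.
have z'1 i : `|z' 0 i| <= 1.
  by have := z1 (rshift 1 i); rewrite zE row_mxEr.
have [t tG wt] := HG w wb; have [s sT' zs] := HT z' z'1.
exists (row_mx (t%:M : 'M[R]_1) (t *: (u^-1 *: r) + s)).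
  by apply/allpairsP; exists (t, s).
have C1 : 1 + C0 <= C by rewrite /C; lra.
rewrite zV => i; case: (split_ordP i) => j ->.
  rewrite !row_mxEl !ord1 !mxE eqxx !mulr1n (le_trans wt) //.
  by rewrite ler_peMl ?ltW // (lt_le_trans _ C1) //; lra.
rewrite !row_mxEr mxE [X in _ - X]mxE opprD addrACA.
rewrite (le_trans (ler_normD _ _)) //.
apply: (@le_trans _ _ (rho + C0 * rho')).
  rewrite lerD // mxE [X in _ - X]mxE -mulrBl normrM -[leRHS]mulr1 ler_pM //.
  by rewrite mxE mulrC.
apply: (@le_trans _ _ ((1 + C0) * rho)); last by rewrite ler_wpM2r // ltW.
by rewrite mulrDl mul1r lerD2l ler_wpM2l.
Qed.

(** Permuting rows and columns brings the largest entry to the corner. The induction is over all [b]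
    because the Schur complement doubles the bound on the entries. *)
Lemma cube_coveredP n (b : R) : 1 <= b -> exists C, 0 <= C /\
  forall V : 'M[R]_n, (forall i j, `|V i j| <= b) -> cube_covered V C.
Proof.
elim: n b => [|n IH] b b1.
  exists 1; split => // V _; rewrite /cube_covered det_mx00 normr1; split => //.
  move=> rho _ _; exists [:: 0]; split; first by rewrite expr0 !mulr1.
  by move=> z _; exists 0 => [|[]]; rewrite ?mem_head.
have [|C0 [C00 H]] := IH (2 * b); first by lra.
exists (b * C0 + (1 + C0) + (2 * n.+1%:R + 3 * C0) * (C0 * b ^+ n)).
have b0 : 0 <= b by lra.
split; first by rewrite !addr_ge0 ?mulr_ge0 ?addr_ge0 ?mulr_ge0 ?exprn_ge0.
move=> V Vb; set C := (X in cube_covered _ X).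
pose ij := [arg max_(x > ((0, 0) : 'I_n.+1 * 'I_n.+1)) `|V x.1 x.2|]%O.
have ijmax i j : `|V i j| <= `|V ij.1 ij.2|.
  by rewrite /ij; case: Order.TotalTheory.arg_maxP => // x _ /(_ (i, j) isT).
pose s := tperm 0 ij.1; pose t := tperm 0 ij.2.
pose V' : 'M[R]_(1 + n) := row_perm s (col_perm t V).
have V'E i j : V' i j = V (s i) (t j) by rewrite !mxE.
have detV' : `|\det V'| = `|\det V|.
  rewrite /V' row_permE col_permE !det_mulmx !det_perm !normrM !normrX normrN1.
  by rewrite !expr1n mul1r mulr1.
have [||h1 h2] := @cube_covered_pivot n b C0 b1 C00 H V'.
- by move=> i j; rewrite V'E.
- by move=> i j; rewrite !V'E !tpermL.
rewrite -/C detV' in h1 h2; split => // rho r0 r1.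
have [S [sS HS]] := h2 rho r0 r1.
exists [seq col_perm t^-1 c | c <- S]; split; first by rewrite size_map.
move=> z z1; have [|c cS zc] := HS (col_perm s z).
  by move=> i; rewrite mxE.
exists (col_perm t^-1 c); first exact: map_f.
move=> i; have := zc (t^-1 i)%g.
have -> : (col_perm s z *m V') 0 (t^-1 i)%g = (z *m V) 0 i.
  rewrite !mxE [RHS](reindex_inj (@perm_inj _ s)) /=; apply: eq_bigr => k _.
  by rewrite V'E mxE permKV.
by rewrite [col_perm _ _ 0 i]mxE.
Qed.

End covering.

(** * Hausdorff measure *)

Lemma geometric_small (R : realType) (a t e : R) : 0 <= t -> t < 1 -> 0 < e ->
  exists j : nat, a * t ^+ j <= e.
Proof.
move=> t0 t1 e0.
have : ((fun j => a * t ^+ j) @ \oo --> a * 0)%classic.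
  by apply: cvgM; [exact: cvg_cst|apply: cvg_expr; rewrite ger0_norm].
rewrite mulr0 => /cvgr_le /(_ e e0) [N _ HN].
by exists N; apply: (HN N) => /=.
Qed.

Section hausdorff.
Local Open Scope classical_set_scope.
Variables (R : realType) (T : metricType R).
Implicit Types (A U : set T) (s e : R).

Lemma diam_set0 : diam (set0 : set T) = -oo%E.
Proof.
rewrite /diam; apply/eqP; rewrite -leeNy_eq; apply: ge_ereal_sup.
by move=> _ [x [] []].
Qed.

Lemma poweR_diam_le U s e : 0 < s -> (diam U <= e%:E)%E ->
  (poweR (diam U) s <= (powR e s)%:E)%E.
Proof.
move=> s0 Ue; have [U0|/set0P[x Ux]] := eqVneq U set0.
  by rewrite U0 diam_set0 poweRNyr ?gt_eqF // lee_fin powR_ge0.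
have d0 : (0 <= diam U)%E.
  by apply: ereal_sup_ubound; exists (x, x) => //=; rewrite mdistxx.
rewrite -poweR_EFin; apply: gt0_ler_poweR => //; first exact: ltW.
- by rewrite in_itv /= d0 leey.
- by rewrite in_itv /= (le_trans d0 Ue) leey.
Qed.

Lemma sum_nth_le (f : set T -> \bar R) (L : seq (set T)) N :
  (forall U, (0 <= f U)%E) -> f set0 = 0%E ->
  (\sum_(0 <= j < N) f (nth set0 L j) <= \sum_(U <- L) f U)%E.
Proof.
move=> f0 fs0; elim: L N => [|U L IH] [|N].
- by rewrite big_geq ?big_nil.
- by rewrite big_nil big1 // => i _; rewrite nth_nil fs0.
- by rewrite big_geq // sume_ge0.
- by rewrite big_nat_recl // big_cons leeD2l // IH.
Qed.

(** Nullity through finite covers, as the lists of nodes provide them; infinite covers appear only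
    in the countable union. *)
Definition finely_covered s A := forall e, 0 < e -> exists L : seq (set T),
  [/\ A `<=` \bigcup_j nth set0 L j, forall j, (diam (nth set0 L j) <= e%:E)%E
    & (\sum_(U <- L) poweR (diam U) s <= e%:E)%E].

Lemma hausdorff_measure_bigcup s (A : nat -> set T) : 0 < s ->
  (forall i, finely_covered s (A i)) -> hausdorff_measure s (\bigcup_i A i) = 0%E.
Proof.
move=> s0 Afine; apply/eqP; rewrite eq_le; apply/andP; split; last first.
  apply: (@le_trans _ _ (hausdorff_premeasure s 1 (\bigcup_i A i))).
    apply: le_ereal_inf_tmp => _ [U _ <-].
    by apply: nneseries_ge0 => i _ _; exact: poweR_ge0.
  by apply: ereal_sup_ubound; exists 1 => //=.
apply: ge_ereal_sup => _ [e /= e0 <-].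
apply/lee_addgt0Pr => eps eps0; rewrite add0e.
pose d i := Num.min e (eps / (2 ^ i.+1)%:R).
have d0 i : 0 < d i by rewrite lt_min e0 divr_gt0 // ltr0n expn_gt0.
have [L HL] := choice (fun i => Afine i _ (d0 i)).
pose V (ij : nat * nat) := nth set0 (L ij.1) ij.2.
(* The covers of all the [A i] are listed as a single sequence through a bijection between [nat] and
   [nat * nat]. *)
have /card_esym/ppcard_eqP[f] := card_nat2.
apply: (@le_trans _ _ (\sum_(0 <= n <oo) poweR (diam (V (f n))) s)%E).
  apply: ereal_inf_lbound; exists (V \o f) => //; split => [x [i _ Aix]|n] /=.
    have [h _ _] := HL i; have [j _ Ux] := h x Aix.
    by exists (f^-1%FUN (i, j)) => //=; rewrite invK ?inE.
  have [_ h _] := HL (f n).1; apply: le_trans (h _) _.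
  by rewrite lee_fin ge_min lexx.
pose F ij := poweR (diam (V ij)) s.
have F0 ij : (0 <= F ij)%E by exact: poweR_ge0.
have -> : (\sum_(0 <= n <oo) F (f n))%E = (\sum_(0 <= i <oo) \sum_(0 <= j <oo) F (i, j))%E.
  rewrite nneseries_esumT // -(@reindex_esum R _ _ setT setT f F) //.
  rewrite nneseries_esumT; last by move=> i; exact: nneseries_ge0.
  transitivity (\esum_(i in setT) \esum_(j in setT) F (i, j)); last first.
    by apply: eq_esum => i _; rewrite nneseries_esumT.
  rewrite (@esum_esum R _ _ setT (fun=> setT) (fun i j => F (i, j))) //.
  rewrite (_ : [set: nat * nat] = [set: nat] `*`` (fun=> [set: nat])).
    by apply: eq_esum => -[].
  by apply/seteqP; split => // -[].
apply: le_trans (epsilon_trick0 xpredT (ltW eps0)).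
apply: lee_nneseries => [i _ _|i _]; first exact: nneseries_ge0.
have [_ _ hL] := HL i.
apply: (@le_trans _ _ (\sum_(U <- L i) poweR (diam U) s)%E); last first.
  by apply: le_trans hL _; rewrite lee_fin ge_min lexx orbT.
apply: lime_le; first by apply: is_cvg_nneseries => j _ _; exact: F0.
apply: nearW => N.
have h := @sum_nth_le (fun U => poweR (diam U) s) (L i) N
  (fun U => poweR_ge0 (diam U) s).
by apply: h; rewrite diam_set0 poweRNyr // gt_eqF.
Qed.

End hausdorff.

(** * Simplices with vertices in the standard simplex *)

Section simplex.
Variable R : realType.

(* In the coordinates of index > 0, the simplex is the image of a part of the
   cube by the matrix of the differences of its vertices with the first one. *)
Lemma simplex_covered n : exists C : R, 0 <= C /\
  forall P : 'M[R]_(1 + n), (forall i j, 0 <= P i j <= 1) ->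
    (forall i, \sum_j P i j = 1) -> forall rho, 0 < rho -> rho <= `|\det P| ->
  exists S : seq 'rV[R]_(1 + n), (size S)%:R * rho ^+ n <= C * `|\det P| /\
  forall z : 'rV[R]_(1 + n), (forall i, 0 <= z 0 i) -> \sum_i z 0 i = 1 ->
    exists2 c, c \in S & forall i, `|(z *m P) 0 i - c 0 i| <= C * rho.
Proof.
have [C0 [C00 HC]] := cube_coveredP n (lexx (1 : R)).
(* The coordinate of index 0 is 1 minus the sum of the others, which multiplies the error by up to
   [n]. *)
exists (C0 * n.+1%:R); split; first by rewrite mulr_ge0.
move=> P P01 P1 rho r0 rdet.
pose one_col : 'cV[R]_n := const_mx 1.
pose v0 : 'rV[R]_n := ursubmx P.
pose D : 'M[R]_n := drsubmx P - one_col *m v0.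
(* As the rows of [P] sum to 1, adding all columns to the first and subtracting the first row from
   the others leaves the first column [1, 0, ..., 0]; hence [\det P = \det D]. *)
have PE : P = block_mx 1%:M 0 one_col 1%:M *m block_mx 1%:M v0 0 D *m
              block_mx 1%:M 0 (- one_col) 1%:M.
  rewrite !mulmx_block !mul1mx !mul0mx !mulmx1 !mulmx0 !addr0 !add0r.
  have row0 i : P i (lshift n (0 : 'I_1)) = 1 - \sum_j P i (rshift 1 j).
    by rewrite -(P1 i) big_split_ord /= big_ord1 addrK.
  rewrite -[LHS]submxK /D; congr block_mx.
  - apply/matrixP => i j; rewrite !ord1 !mxE row0 eqxx; congr (_ + _).
    by rewrite -sumrN; apply: eq_bigr => k _; rewrite !mxE mulrN mulr1.
  - apply/matrixP => i j; rewrite !ord1 !mxE row0; congr (_ + _).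
    by rewrite -sumrN; apply: eq_bigr => k _; rewrite !mxE big_ord1 !mxE; ring.
  - by rewrite addrC subrK.
have detP : \det P = \det D.
  by rewrite PE !det_mulmx !det_lblock det_ublock !det1 !mul1r !mulr1.
have DE i j : D i j = P (rshift 1 i) (rshift 1 j) - P 0 (rshift 1 j).
  by rewrite !mxE big_ord1 !mxE mul1r; congr (_ - P _ _); apply: val_inj.
have [|_ /(_ rho r0)] := HC D.
  move=> i j; rewrite DE ler_norml; have := P01 (rshift 1 i) (rshift 1 j).
  have := P01 0 (rshift 1 j); move=> /andP[? ?] /andP[? ?]; apply/andP; split; lra.
rewrite -detP => /(_ rdet) [S [sS HS]].
exists [seq row_mx ((1 - \sum_j (v0 + c) 0 j)%:M : 'M[R]_1) (v0 + c) | c <- S]; split.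
  rewrite size_map (le_trans sS) // ler_wpM2r // ler_peMr // ler1n //.
move=> z z0 z1.
have z'1 i : `|rsubmx z 0 i| <= 1.
  rewrite mxE ger0_norm // -z1 (bigD1 (rshift 1 i)) //= lerDl.
  by rewrite sumr_ge0.
have [c cS zc] := HS _ z'1.
exists (row_mx ((1 - \sum_j (v0 + c) 0 j)%:M : 'M[R]_1) (v0 + c)); first exact: map_f.
have C0n : C0 * rho <= C0 * n.+1%:R * rho.
  by rewrite ler_wpM2r ?ler_peMr ?ler1n // ltW.
have tail j : (z *m P) 0 (rshift 1 j) = (v0 + rsubmx z *m D) 0 j.
  rewrite !mxE big_split_ord /= big_ord1.
  have -> : z 0 (lshift n (0 : 'I_1)) = 1 - \sum_k z 0 (rshift 1 k).
    by rewrite -z1 big_split_ord /= big_ord1 addrK.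
  under [in RHS]eq_bigr => k _ do rewrite DE mxE mulrBr.
  rewrite sumrB -mulr_suml.
  have -> : P (lshift n (0 : 'I_1)) (rshift 1 j) = P 0 (rshift 1 j).
    by congr (P _ _); exact: val_inj.
  ring.
have tail_le j : `|(z *m P) 0 (rshift 1 j) - (v0 + c) 0 j| <= C0 * rho.
  rewrite tail [in X in X - _]mxE [in X in _ - X]mxE opprD addrACA subrr add0r.
  exact: zc.
move=> i; case: (split_ordP i) => j ->; last by rewrite row_mxEr (le_trans (tail_le j)).
have zP1 : \sum_i (z *m P) 0 i = 1.
  under eq_bigr do rewrite mxE.
  rewrite exchange_big /= -[RHS]z1; apply: eq_bigr => k _.
  by rewrite -mulr_sumr P1 mulr1.
have -> : (z *m P) 0 (lshift n j) = 1 - \sum_j (z *m P) 0 (rshift 1 j).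
  by rewrite -zP1 big_split_ord /= big_ord1 ord1 addrK.
rewrite row_mxEl !ord1 [X in _ - X]mxE eqxx mulr1n.
set a := \sum_j (z *m P) 0 _; set b := \sum_j (v0 + c) 0 j.
have -> : 1 - a - (1 - b) = \sum_j ((v0 + c) 0 j - (z *m P) 0 (rshift 1 j)).
  by rewrite sumrB -/a -/b; ring.
apply: le_trans (ler_norm_sum _ _ _) _.
apply: (@le_trans _ _ (\sum_(k < n) C0 * rho)).
  by apply: ler_sum => k _; rewrite distrC.
rewrite sumr_const card_ord -[leLHS]mulr_natl mulrAC [leLHS]mulrC.
rewrite ler_wpM2l ?mulr_ge0 ?ler_nat // ltW //.
Qed.

End simplex.

(** * From Rauzy cones to Hausdorff sums *)

Section cover.
Local Open Scope classical_set_scope.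
Variables (R : realType) (n : nat).
Hypothesis n_gt0 : (0 < n)%N.
Implicit Types m : node R n.
Local Notation PP := (Pplus R n.+1).

Lemma weight_det m : wf m ->
  \det (\matrix_(i, j) (m.2 i j / height m i)) = weight m.
Proof.
move=> wfm; have -> : \matrix_(i, j) (m.2 i j / height m i) =
    diag_mx (\row_i (height m i)^-1) *m m.2.
  by apply/matrixP => i j; rewrite mul_diag_mx !mxE mulrC.
rewrite det_mulmx det_diag; case: wfm => _ _ _ ->; rewrite mulr1.
by apply: eq_bigr => i _; rewrite mxE.
Qed.

Lemma sum_simplex_chart (x : PP) : \sum_i simplex_chart x 0 i = 1.
Proof.
rewrite /simplex_chart; under eq_bigr do rewrite mxE.
rewrite -mulr_sumr mulVf //; apply/eqP => /vec_sum_eq0.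
by [].
Qed.

Definition chart_box (c : 'rV[R]_n.+1) (r : R) : set PP :=
  [set x | forall i, `|simplex_chart x 0 i - c 0 i| <= r].

Lemma diam_chart_box (c : 'rV[R]_n.+1) (r : R) : 0 <= r ->
  (diam (chart_box c r) <= (2 * r)%:E)%E.
Proof.
move=> r0; apply: ge_ereal_sup => _ [[x y] /= [hx hy] <-].
rewrite lee_fin; change (`|simplex_chart x - simplex_chart y| <= 2 * r).
rewrite /Num.norm /=.
have [->|/mx_norm_neq0[[i j] -> /=]] :=
    eqVneq (mx_norm (simplex_chart x - simplex_chart y)) 0.
  by rewrite mulr_ge0.
rewrite ord1 mxE [(- simplex_chart y) 0 j]mxE; move: (hx j) (hy j).
rewrite !ler_norml.
move=> /andP[? ?] /andP[? ?]; apply/andP; split; lra.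
Qed.

(** [simplex_covered] at the largest scale that it allows, [rho = weight m]. *)
Lemma node_covered : exists C : R, 0 <= C /\
  forall m, wf m -> exists L : seq (set PP),
    [/\ forall x y, nonneg y -> simplex_chart x = y *m m.2 ->
          (\bigcup_j nth set0 L j) x,
        forall j, (diam (nth set0 L j) <= (C * weight m)%:E)%E
      & (size L)%:R * weight m ^+ n <= C * weight m].
Proof.
have [C [C0 HC]] := simplex_covered R n.
exists (2 * C); split; first by rewrite mulr_ge0.
move=> m wfm; have w0 := weight_gt0 wfm.
pose P : 'M[R]_(1 + n) := \matrix_(i, j) (m.2 i j / height m i).
have detP : \det P = weight m by exact: weight_det.
have h0 i := height_gt0 i wfm.
have P1 i : \sum_j P i j = 1.
  under eq_bigr do rewrite mxE; rewrite -mulr_suml mulfV //.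
  by rewrite gt_eqF //; exact: h0.
have P0 i j : 0 <= P i j.
  by rewrite mxE divr_ge0 ?(ltW (h0 i)) //; case: wfm => _ h _ _; exact: h.
have P01 i j : 0 <= P i j <= 1.
  by rewrite P0 /= -(P1 i) (bigD1 j) //= lerDl sumr_ge0.
have [|S [sS HS]] := HC P P01 P1 _ w0; first by rewrite detP ger0_norm // ltW.
rewrite detP (ger0_norm (ltW w0)) in sS HS.
exists [seq chart_box c (C * weight m) | c <- S].
split.
(* [z] gives the barycentric coordinates of [x] with respect to the normalized rows. *)
- move=> x y y0 xy; pose z : 'rV[R]_(1 + n) := \row_i (y 0 i * height m i).
  have zP : z *m P = simplex_chart x.
    rewrite xy; apply/rowP => j; rewrite !mxE; apply: eq_bigr => i _.
    by rewrite !mxE; field; rewrite gt_eqF.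
  have [||c cS cx] := HS z.
  + by move=> i; rewrite mxE mulr_ge0 // ltW.
  + rewrite -(sum_simplex_chart x) -zP; under [RHS]eq_bigr do rewrite mxE.
    by rewrite exchange_big /=; apply: eq_bigr => i _; rewrite -mulr_sumr P1 mulr1.
  exists (index c S) => //=; rewrite (nth_map 0) ?index_mem // nth_index //.
  by move=> i; rewrite -zP.
- move=> j; have [lt|ge] := ltnP j (size S).
    rewrite (nth_map 0) // -mulrA; apply: diam_chart_box.
    by rewrite mulr_ge0 // ltW.
  by rewrite nth_default ?size_map // diam_set0 leNye.
- rewrite size_map (le_trans sS) // -mulrA ler_peMl ?ler1n //.
  by rewrite mulr_ge0 // ltW.
Qed.

Lemma bigcup_nth_cat (L L' : seq (set PP)) :
  \bigcup_j nth set0 (L ++ L') j =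
  (\bigcup_j nth set0 L j) `|` (\bigcup_j nth set0 L' j).
Proof.
apply/seteqP; split => x.
  move=> [j _]; rewrite nth_cat.
  by case: ltnP => _ xj; [left; exists j|right; exists (j - size L)%N].
move=> [[j _ xj]|[j _ xj]].
  exists j => //; rewrite nth_cat; case: ltnP => // h.
  by move: xj; rewrite nth_default.
by exists (size L + j)%N => //; rewrite nth_cat ltnNge leq_addr /= addKn.
Qed.

Lemma sum_nth_const (f : set PP -> \bar R) (L : seq (set PP)) (c : R) :
  (forall j, (f (nth set0 L j) <= c%:E)%E) ->
  (\sum_(U <- L) f U <= ((size L)%:R * c)%:E)%E.
Proof.
move=> fc; elim: L fc => [|U L IH] fc; first by rewrite big_nil mul0r.
have -> : (size (U :: L))%:R * c = c + (size L)%:R * c by rewrite /= -natr1; ring.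
rewrite big_cons EFinD leeD //; first exact: (fc 0%N).
by apply: IH => j; exact: (fc j.+1).
Qed.

Lemma weightV_le m (M : R) : wf m -> (forall i, height m i <= M) ->
  (weight m)^-1 <= M ^+ n.+1.
Proof.
move=> wfm mM; rewrite /weight prodfV invrK.
rewrite -[X in M ^+ X](card_ord n.+1) -prodr_const.
by apply: ler_prod => i _; rewrite mM ltW // height_gt0.
Qed.

Variable eta : R.
Hypothesis eta01 : 0 < eta < 1.
Local Notation s := (n%:R - eta).

(** Compared with exponent [n], the sum loses a factor [weight m ^ (- eta)], and [1 / weight m] is a
    product of [n.+1] heights. *)
Lemma powR_weight (C M : R) m (k : nat) : 0 <= C -> wf m ->
  (forall i, height m i <= M) -> k%:R * weight m ^+ n <= C * weight m ->
  k%:R * (C * weight m) `^ s <= C `^ s * C * (M ^+ n.+1) `^ eta * weight m.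
Proof.
move=> C0 wfm mM hk; have w0 := weight_gt0 wfm.
rewrite powRM ?(ltW w0) // [X in _ * (_ * X)]powRB ?(gt_eqF w0) ?implybT //.
rewrite powR_mulrn ?(ltW w0) //.
have wV : (weight m `^ eta)^-1 <= (M ^+ n.+1) `^ eta.
  rewrite -powR_inv1 ?powR_ge0 // -powRrM mulrC powRrM powR_inv1 ?(ltW w0) //.
  have eta0 : 0 <= eta by case/andP: eta01 => /ltW.
  have wM := weightV_le wfm mM.
  apply: (ge0_ler_powR eta0) => //; rewrite nnegrE ?invr_ge0 ?(ltW w0) //.
  by rewrite (le_trans _ wM) // invr_ge0 ltW.
have -> : k%:R * (C `^ s * (weight m ^+ n / weight m `^ eta)) =
  C `^ s * (k%:R * weight m ^+ n) * (weight m `^ eta)^-1 by ring.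
have -> : C `^ s * C * (M ^+ n.+1) `^ eta * weight m =
  C `^ s * (C * weight m) * (M ^+ n.+1) `^ eta by ring.
apply: ler_pM => //; first by rewrite !mulr_ge0 ?powR_ge0 ?exprn_ge0 // ltW.
- by rewrite invr_ge0 powR_ge0.
- by rewrite ler_wpM2l ?powR_ge0.
Qed.

Lemma s_gt0 : 0 < s.
Proof.
have /andP[_ e1] := eta01; rewrite subr_gt0 (lt_le_trans e1) // ler1n //.
Qed.

Lemma nodes_covered : exists C : R, 0 <= C /\
  forall (Ls : seq (node R n)) (M w : R), 0 <= M ->
    (forall m, m \in Ls -> wf m /\ forall i, height m i <= M) ->
    \sum_(m <- Ls) weight m <= w ->
  exists L : seq (set PP),
    [/\ forall x m y, m \in Ls -> nonneg y -> simplex_chart x = y *m m.2 ->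
          (\bigcup_j nth set0 L j) x,
        forall j, (diam (nth set0 L j) <= (C * w)%:E)%E
      & (\sum_(U <- L) poweR (diam U) s <= (C * (M ^+ n.+1) `^ eta * w)%:E)%E].
Proof.
have [C [C0 HC]] := node_covered.
pose C' := Num.max C (C `^ s * C).
have C'0 : 0 <= C' by rewrite le_max C0.
exists C'; split => // Ls M w M0; elim: Ls w => [|m Ls IH] w hLs hw.
  exists [::]; split => //.
    move=> j; rewrite nth_nil diam_set0 leNye //.
  rewrite big_nil lee_fin !mulr_ge0 ?powR_ge0 //.
  by move: hw; rewrite big_nil.
have [wfm mM] := hLs m (mem_head _ _).
have w0 := weight_gt0 wfm.
rewrite big_cons in hw.
have hLs' m' : m' \in Ls -> wf m' /\ forall i, height m' i <= M.
  by move=> h; apply: hLs; rewrite inE h orbT.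
have [|L [h1 h2 h3]] := IH (w - weight m) hLs'; first by lra.
have [Lm [k1 k2 k3]] := HC m wfm.
have sum0 : 0 <= w - weight m.
  have : 0 <= \sum_(m <- Ls) weight m.
    rewrite big_seq sumr_ge0 // => m' /hLs'[wfm' _]; exact/ltW/weight_gt0.
  lra.
exists (Lm ++ L); rewrite bigcup_nth_cat; split.
- move=> x m' y; rewrite inE => /orP[/eqP->|m'L] y0 xy.
    by left; exact: k1 xy.
  by right; exact: h1 xy.
- move=> j; rewrite nth_cat; case: ltnP => _.
    apply: le_trans (k2 j) _; rewrite lee_fin ler_pM ?(ltW w0) //.
      by rewrite le_max lexx.
    by rewrite -subr_ge0.
  apply: le_trans (h2 _) _; rewrite lee_fin ler_wpM2l //.
  by rewrite lerBlDr lerDl ltW.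
- rewrite big_cat /=.
  have -> : C' * (M ^+ n.+1) `^ eta * w = C' * (M ^+ n.+1) `^ eta * weight m +
     C' * (M ^+ n.+1) `^ eta * (w - weight m) by ring.
  rewrite EFinD leeD //.
  apply: (@le_trans _ _ ((size Lm)%:R * (C * weight m) `^ s)%:E).
    by apply: sum_nth_const => j; apply: poweR_diam_le (k2 j); exact: s_gt0.
  rewrite lee_fin; apply: le_trans (powR_weight C0 wfm mM k3) _.
  rewrite ler_wpM2r ?(ltW w0) // ler_wpM2r ?powR_ge0 //.
  by rewrite le_max lexx orbT.
Qed.

Lemma bad_finely_covered gam (kap K : R) m : 0 <= kap -> kap < 1 -> 1 <= K ->
  kap * (K ^+ n.+1) `^ eta < 1 -> wf m ->
  (forall j M, (forall i, height m i <= M) ->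
     coverable gam (bad gam m) (kap ^+ j * weight m) (K ^+ j * M)) ->
  finely_covered s [set x : PP | bad gam m (simplex_chart x)].
Proof.
move=> kap0 kap1 K1 th1 wfm Hcov e e0.
have w0 := weight_gt0 wfm.
have [C [C0 HC]] := nodes_covered.
pose M := \sum_i height m i.
have mM i : height m i <= M.
  rewrite /M (bigD1 i) //= lerDl sumr_ge0 // => j _; exact/ltW/height_gt0.
have M0 : 0 <= M by rewrite sumr_ge0 // => j _; exact/ltW/height_gt0.
set th := kap * _ in th1.
have th0 : 0 <= th by rewrite mulr_ge0 // powR_ge0.
have [j [j1 j2]] : exists j : nat, C * weight m * kap ^+ j <= e /\
   C * (M ^+ n.+1) `^ eta * weight m * th ^+ j <= e.
  have [j1 h1] := geometric_small (C * weight m) kap0 kap1 e0.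
  have [j2 h2] := geometric_small (C * (M ^+ n.+1) `^ eta * weight m) th0 th1 e0.
  exists (j1 + j2)%N; split; [apply: le_trans h1|apply: le_trans h2].
    by rewrite ler_wpM2l ?mulr_ge0 ?(ltW w0) // ler_wiXn2l ?(ltW kap1) ?leq_addr.
  by rewrite ler_wpM2l ?mulr_ge0 ?powR_ge0 ?(ltW w0) // ler_wiXn2l ?(ltW th1) ?leq_addl.
have [Ls [c1 c2 c3]] := Hcov j M mM.
have KM0 : 0 <= K ^+ j * M by rewrite mulr_ge0 // exprn_ge0 // (le_trans ler01).
have [L [h1 h2 h3]] := HC Ls (K ^+ j * M) _ KM0 c2 c3.
exists L; split.
- move=> x /c1 [m' m'L [y [y0 _] yx]].
  by apply: h1 m'L y0 _; rewrite yx.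
- move=> i; apply: le_trans (h2 i) _; rewrite lee_fin (le_trans _ j1) //.
  by rewrite mulrA mulrAC.
- apply: le_trans h3 _; rewrite lee_fin (le_trans _ j2) //.
  have K0 : 0 <= K by exact: le_trans K1.
  have -> : ((K ^+ j * M) ^+ n.+1) `^ eta =
      ((K ^+ n.+1) `^ eta) ^+ j * (M ^+ n.+1) `^ eta.
    rewrite exprMn powRM ?exprn_ge0 //; congr (_ * _).
    rewrite -exprM mulnC exprM -[_ ^+ j]powR_mulrn ?exprn_ge0 // powRAC.
    by rewrite powR_mulrn ?powR_ge0.
  by rewrite /th exprMn; rewrite le_eqVlt; apply/orP; left; apply/eqP; ring.
Qed.

End cover.

(** * Invariant measures and Rauzy induction *)

Section equivariant.
Variables (R : realType) (n : nat).
Hypothesis n_gt0 : (0 < n)%N.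
Implicit Types (s : state n) (p : 'S_n.+1) (l : 'rV[R]_n.+1) (F : R -> R).

Definition total l : R := \sum_i l 0 i.

Definition pos p l i : R := \sum_(j | (p j < p i)%N) l 0 j.

(* [F] stands for the distribution function of an invariant measure. *)
Definition equivariant s l F := forall i y, 0 <= y <= l 0 i ->
  F (pos s.1 l i + y) - F (pos s.1 l i) = F (pos s.2 l i + y) - F (pos s.2 l i).

(** The masses of the exchanged intervals, read in the top row; [equivariant] gives the same values
    in the bottom row. *)
Definition increments s l F : 'rV[R]_n.+1 :=
  \row_i (F (pos s.1 l i + l 0 i) - F (pos s.1 l i)).

Lemma equivariant_swap s l F : equivariant s l F -> equivariant (swap s) l F.
Proof. by move=> h i y /h. Qed.

Lemma increments_swap s l F : nonneg l -> equivariant s l F ->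
  increments (swap s) l F = increments s l F.
Proof. by move=> l0 h; apply/rowP => i; rewrite !mxE h // l0 lexx. Qed.

Lemma vec_step_swap e s l : vec_step e (swap s) l = vec_step (~~ e) s l.
Proof. by rewrite /vec_step !winner_swap negbK. Qed.

Lemma pos_ge0 p l i : nonneg l -> 0 <= pos p l i.
Proof. by move=> l0; apply: sumr_ge0. Qed.

Lemma pos_lt p l i j : nonneg l -> (p i < p j)%N -> pos p l i + l 0 i <= pos p l j.
Proof.
move=> l0 ij; rewrite /pos [leRHS](bigID (fun k => (p k < p i)%N)) /=; apply: lerD.
  rewrite le_eqVlt; apply/orP; left; apply/eqP; apply: eq_bigl => k.
  by apply/idP/andP => [h|[]//]; split => //; exact: ltn_trans ij.
by rewrite (bigD1 i) /= ?ltnn ?andbT // lerDl; exact: sumr_ge0.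
Qed.

Lemma pos_total p l i : nonneg l -> pos p l i + l 0 i <= total l.
Proof.
move=> l0; rewrite /pos /total [leRHS](bigID (fun j => (p j < p i)%N)) /= lerD2l.
by rewrite (bigD1 i) ?ltnn //= lerDl sumr_ge0.
Qed.

Lemma pos_last_top s l : pos s.1 l (winner true s) = total l - l 0 (winner true s).
Proof.
rewrite /total (bigD1 (winner true s)) //= addrC addrK; apply: eq_bigl => j.
rewrite pos_winner; have [->|ja] := eqVneq j; first by rewrite pos_winner ltnn.
exact: lt_pos_top.
Qed.

Lemma pos_last_bottom s l :
  pos s.2 l (winner false s) = total l - l 0 (winner false s).
Proof. exact: (@pos_last_top (swap s)). Qed.

Lemma pos_top_rauzy s l i : pos s.1 (vec_step true s l) i = pos s.1 l i.
Proof.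
apply: eq_bigr => j ji; rewrite vec_stepE /=.
have [E|] := eqVneq j (winner true s); last by rewrite subr0.
move: ji; rewrite E pos_winner => h; have := leq_trans h (leq_ord (s.1 i)).
by rewrite ltnn.
Qed.

(** The winner is shortened by the loser's length and the loser is inserted right after it: beyond
    this pair the two changes cancel. *)
Lemma pos_bottom_rauzy s l i : irreducible s ->
  pos (rauzy true s).2 (vec_step true s l) i =
  if i == winner false s
  then pos s.2 l (winner true s) + l 0 (winner true s) - l 0 (winner false s)
  else pos s.2 l i.
Proof.
move=> irrs; set a := winner true s; set x := winner false s; set b := (rauzy true s).2.
have ax : a != x by exact: winner_neq.
have sE : pos b (vec_step true s l) i =
    \sum_(j | (b j < b i)%N) l 0 j - l 0 x *+ (b a < b i)%N.
  rewrite /pos (eq_bigr _ (fun j _ => vec_stepE _ _ _ _)) sumrB; congr (_ - _).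
  have [h|h] := boolP (b a < b i)%N.
    by rewrite (bigD1 a) //= eqxx big1 ?addr0 // => j /andP[_ /negbTE->].
  rewrite big1 // => j ji; have [E|//] := eqVneq j a.
  by move: ji; rewrite E (negbTE h).
have ba_n : (s.2 a < n)%N by exact: lt_pos_bottom.
have bx : s.2 x = n :> nat by rewrite pos_winner.
have bE j : b j = reinsert_nat (s.2 a) n (s.2 j) :> nat by exact: rauzy_bottom.
have bxE : b x = (s.2 a).+1 :> nat by rewrite bE /reinsert_nat bx leqNgt ba_n eqxx.
have baE : b a = s.2 a :> nat by rewrite bE /reinsert_nat leqnn.
have neqx j : j != x -> (s.2 j < n)%N by exact: lt_pos_bottom.
rewrite sE; have [ix|ix] := eqVneq i x.
  rewrite ix bxE baE ltnSn mulr1n (bigD1 a) /= ?baE // addrC; congr (_ + _ - _).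
  apply: eq_bigl => j; rewrite bE -(inj_eq (@perm_inj _ s.2)) -val_eqE /=.
  exact: reinsert_nat_last ba_n (leq_ord _).
have bab : (b a < b i)%N = (b x < b i)%N.
  by rewrite bxE baE bE; apply: reinsert_nat_gt => //; exact: neqx.
have cond j : j != x -> (b j < b i)%N = (s.2 j < s.2 i)%N.
  by move=> /neqx jn; rewrite !bE reinsert_nat_mono // neqx.
have xi : (s.2 x < s.2 i)%N = false by rewrite bx ltnNge leq_ord.
rewrite bab /pos; have [h|h] := boolP (b x < b i)%N.
  rewrite (bigD1 x) //= mulr1n addrAC subrr add0r; apply: eq_bigl => j.
  by have [->|jx] := eqVneq j x; rewrite ?andbF ?xi // andbT cond.
rewrite subr0; apply: eq_bigl => j.
by have [->|jx] := eqVneq j x; rewrite ?xi ?(negbTE h) // cond.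
Qed.

(** On the loser [x] the induced map is a composition of two translations. The bottom interval of
    [x] is the right end of the top interval of the winner [a] ([pax]), which the exchange sends to
    the right end of the bottom interval of [a], the new place of [x]. *)
Lemma equivariant_rauzy_top s l F : irreducible s -> nonneg l ->
  l 0 (winner false s) <= l 0 (winner true s) -> equivariant s l F ->
  equivariant (rauzy true s) (vec_step true s l) F /\
  increments (rauzy true s) (vec_step true s l) F =
  vec_step true s (increments s l F).
Proof.
move=> irrs l0 xa eqF; set a := winner true s; set x := winner false s.
have ax : a != x by exact: winner_neq.
have pax : pos s.2 l x = pos s.1 l a + (l 0 a - l 0 x).
  by rewrite pos_last_top pos_last_bottom addrA subrK.
split.
  move=> i y; rewrite vec_stepE /= pos_top_rauzy pos_bottom_rauzy // -/a -/x.
  have [->|ix] := eqVneq i x.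
    rewrite eq_sym (negbTE ax) subr0 => yl; rewrite eqF // pax -addrA.
    have hy z : 0 <= z <= l 0 x -> F (pos s.1 l a + (l 0 a - l 0 x + z)) -
        F (pos s.1 l a) = F (pos s.2 l a + (l 0 a - l 0 x + z)) - F (pos s.2 l a).
      move=> /andP[z0 z1]; apply: eqF; move: xa; rewrite -/a -/x; lra.
    have := hy y yl; have := hy 0; rewrite !addr0 lexx l0 => /(_ isT).
    rewrite -[pos s.2 l a + l 0 a - l 0 x]addrA -[pos s.2 l a + _ + y]addrA; lra.
  have [->|ia] := eqVneq i a; last by rewrite subr0; exact: eqF.
  rewrite mulr1n => /andP[y0 y1]; apply: eqF; rewrite y0 /=.
  by have := l0 x; lra.
have incE j : increments s l F 0 j = F (pos s.1 l j + l 0 j) - F (pos s.1 l j).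
  by rewrite mxE.
apply/rowP => i; rewrite [RHS]vec_stepE !incE [LHS]mxE vec_stepE /= pos_top_rauzy -/a -/x.
have [->|ia] := eqVneq i a; last by rewrite !subr0.
have := eqF x (l 0 x); rewrite lexx l0 => /(_ isT) ->.
rewrite !mulr1n pax.
have -> : pos s.1 l a + (l 0 a - l 0 x) + l 0 x = pos s.1 l a + l 0 a by ring.
ring.
Qed.

Lemma equivariant_rauzy e s l F : irreducible s -> nonneg l ->
  l 0 (winner (~~ e) s) <= l 0 (winner e s) -> equivariant s l F ->
  equivariant (rauzy e s) (vec_step e s l) F /\
  increments (rauzy e s) (vec_step e s l) F = vec_step e s (increments s l F).
Proof.
case: e => irrs l0 xa eqF; first exact: equivariant_rauzy_top.
have := @equivariant_rauzy_top (swap s) l F (irreducible_swap irrs) l0.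
rewrite !winner_swap rauzy_swap !vec_step_swap => /(_ xa (equivariant_swap eqF)).
rewrite (increments_swap l0 eqF) => -[h1 h2].
have l0' : nonneg (vec_step false s l).
  by move=> i; rewrite vec_stepE /=; case: eqP => [->|_]; rewrite ?subr0 // subr_ge0.
split; first exact: equivariant_swap h1.
by rewrite -h2 increments_swap //; exact: equivariant_swap h1.
Qed.

Lemma loser_le_winner s l :
  l 0 (winner (~~ choice_of s l) s) <= l 0 (winner (choice_of s l) s).
Proof.
rewrite /choice_of; case: (leP (l 0 (winner false s)) (l 0 (winner true s))) => //=.
exact: ltW.
Qed.

Lemma total_vec_step e s l : total (vec_step e s l) = total l - l 0 (winner (~~ e) s).
Proof.
rewrite /total (eq_bigr _ (fun i _ => vec_stepE _ _ _ _)) sumrB; congr (_ - _).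
by rewrite (bigD1 (winner e s)) //= eqxx big1 ?addr0 // => i /negbTE->.
Qed.

Lemma pos_affine p l F c :
  (forall i, F (pos p l i + l 0 i) - F (pos p l i) = c * l 0 i) ->
  forall i, F (pos p l i) = F 0 + c * pos p l i.
Proof.
move=> hF i; have [k] := ubnP (p i : nat); elim: k i => // k IH i; rewrite ltnS => ik.
have [i0|i0] := posnP (p i).
  by rewrite /pos big1 ?mulr0 ?addr0 // => j; rewrite i0.
pose i' := (p^-1)%g (inord (p i).-1).
have pi' : p i' = (p i).-1 :> nat.
  by rewrite permKV inordK // (leq_trans _ (ltn_ord (p i))) // prednK.
have E : pos p l i = pos p l i' + l 0 i'.
  rewrite /pos (bigD1 i') /=; last by rewrite pi' prednK.
  rewrite addrC; congr (_ + _); apply: eq_bigl => j.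
  rewrite pi' -(inj_eq (@perm_inj _ p)) -val_eqE /= pi'.
  by rewrite -(prednK i0) ltnS ltn_neqAle andbC.
have := hF i'; rewrite E => /eqP; rewrite subr_eq => /eqP ->.
by rewrite IH; [ring|rewrite pi' -ltnS prednK].
Qed.

(** For [e = true], a point beyond the induced interval lies in the bottom interval of the loser.
    Translating it to the top interval of the loser brings it inside the induced interval and keeps
    the deviation, as [F] is exactly affine at both left endpoints. *)
Lemma affine_step e s l F c B : irreducible s -> nonneg l ->
  l 0 (winner (~~ e) s) <= l 0 (winner e s) -> equivariant s l F ->
  increments s l F = c *: l ->
  (forall y, 0 <= y <= total (vec_step e s l) -> `|F y - F 0 - c * y| <= B) ->
  forall y, 0 <= y <= total l -> `|F y - F 0 - c * y| <= B.
Proof.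
wlog: e s / e => [H|-> {e}] irrs l0 xa eqF incF HB.
  case: e xa HB => xa HB; first exact: (H true s).
  have irrs' := irreducible_swap irrs; have eqF' := equivariant_swap eqF.
  have xa' : l 0 (winner (~~ true) (swap s)) <= l 0 (winner true (swap s)).
    by rewrite !winner_swap.
  have incF' : increments (swap s) l F = c *: l by rewrite increments_swap.
  by apply: (H true (swap s) isT irrs' l0 xa' eqF' incF'); rewrite vec_step_swap.
set a := winner true s in xa; set x := winner false s in xa.
have ax : a != x by exact: winner_neq.
have inc1 i : F (pos s.1 l i + l 0 i) - F (pos s.1 l i) = c * l 0 i.
  by move/rowP: incF => /(_ i); rewrite !mxE.
have inc2 i : F (pos s.2 l i + l 0 i) - F (pos s.2 l i) = c * l 0 i.
  by rewrite -eqF ?inc1 // l0 lexx.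
have F1 := pos_affine inc1; have F2 := pos_affine inc2.
rewrite total_vec_step /= -/x in HB.
move=> y /andP[y0 yt]; have [yle|ylt] := leP y (total l - l 0 x).
  by apply: HB; rewrite y0.
pose z := y - (total l - l 0 x).
have z01 : 0 <= z <= l 0 x by rewrite /z; lra.
have yE : y = pos s.2 l x + z by rewrite pos_last_bottom -/x /z; ring.
have ptx : pos s.1 l x + l 0 x <= total l - l 0 x.
  apply: (@le_trans _ _ (pos s.1 l a)); last by rewrite pos_last_top lerD2l lerN2.
  by apply: pos_lt => //; rewrite pos_winner lt_pos_top // eq_sym.
have h : `|F (pos s.1 l x + z) - F 0 - c * (pos s.1 l x + z)| <= B.
  apply: HB; have := pos_ge0 s.1 x l0; move: z01 ptx; lra.
have := eqF x z z01; rewrite -yE F1 F2 => E.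
have -> : F y - F 0 - c * y = F (pos s.1 l x + z) - F 0 - c * (pos s.1 l x + z).
  rewrite [in c * y]yE; lra.
exact: h.
Qed.

End equivariant.

(** * Contraction by positive matrices *)

Section nonneg_matrices.
Variables (R : realType) (n : nat).
Implicit Types (u v : 'rV[R]_n.+1) (P Q : 'M[R]_n.+1).

Lemma ler_mulmx u v P : (forall i j, 0 <= P i j) -> (forall i, u 0 i <= v 0 i) ->
  forall i, (u *m P) 0 i <= (v *m P) 0 i.
Proof. by move=> P0 uv i; rewrite !mxE; apply: ler_sum => k _; rewrite ler_wpM2r. Qed.

Lemma mulmx_positive_bounds (L : R) u Q : nonneg u -> (forall i j, 1 <= Q i j <= L) ->
  forall i, total u <= (u *m Q) 0 i <= L * total u.
Proof.
move=> u0 Q1 i; rewrite mxE /total mulr_sumr; apply/andP; split.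
  by apply: ler_sum => k _; rewrite ler_peMr //; case/andP: (Q1 k i).
by apply: ler_sum => k _; rewrite mulrC ler_wpM2r //; case/andP: (Q1 k i).
Qed.

(** An elementary form of Birkhoff's contraction: the interval containing the ratios [v / u]
    replaces the projective metric. *)
Lemma positive_contraction (L lo hi : R) u v Q : 1 <= L -> nonneg u ->
  (forall i j, 1 <= Q i j <= L) -> lo <= hi ->
  (forall i, lo * u 0 i <= v 0 i <= hi * u 0 i) ->
  exists lo' hi', [/\ lo' <= hi', hi' - lo' <= (1 - (2 * L)^-1) * (hi - lo) &
    forall i, lo' * (u *m Q) 0 i <= (v *m Q) 0 i <= hi' * (u *m Q) 0 i].
Proof.
move=> L1 u0 Q1 lohi uv.
have L0 : 0 < L by exact: lt_le_trans L1.
pose w := v - lo *: u; pose z := hi *: u - v.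
have w0 : nonneg w by move=> i; rewrite !mxE subr_ge0; case/andP: (uv i).
have z0 : nonneg z by move=> i; rewrite !mxE subr_ge0; case/andP: (uv i).
have wz : total w + total z = (hi - lo) * total u.
  rewrite /total -big_split mulr_sumr; apply: eq_bigr => i _ /=.
  by rewrite !mxE; ring.
have wQ i : (w *m Q) 0 i = (v *m Q) 0 i - lo * (u *m Q) 0 i.
  by rewrite /w mulmxBl -scalemxAl !mxE.
have zQ i : (z *m Q) 0 i = hi * (u *m Q) 0 i - (v *m Q) 0 i.
  by rewrite /z mulmxBl -scalemxAl !mxE.
pose d := (hi - lo) / (2 * L).
have d0 : 0 <= d by rewrite divr_ge0 ?subr_ge0 // mulr_ge0 // ltW.
have dlt : d <= hi - lo.
  by rewrite ler_pdivrMr ?mulr_gt0 // ler_peMr ?subr_ge0 //; lra.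
have dL i : d * (u *m Q) 0 i <= (hi - lo) * total u / 2.
  have /andP[_ h] := mulmx_positive_bounds u0 Q1 i.
  apply: le_trans (ler_wpM2l d0 h) _; rewrite le_eqVlt; apply/orP; left.
  by apply/eqP; rewrite /d; field; rewrite gt_eqF.
have wzQ i : total w <= (w *m Q) 0 i /\ total z <= (z *m Q) 0 i.
  by split; [have /andP[] := mulmx_positive_bounds w0 Q1 i
            |have /andP[] := mulmx_positive_bounds z0 Q1 i].
have tz0 : 0 <= total z by exact: sumr_ge0.
have tw0 : 0 <= total w by exact: sumr_ge0.
have lenE : (1 - (2 * L)^-1) * (hi - lo) = hi - lo - d by rewrite /d; ring.
(* One of [w] and [z] carries half of [(hi - lo) * total u], and [Q] spreads it
   over all the letters. *)
have [le|lt] := leP (total z) (total w).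
  exists (lo + d), hi; rewrite lenE; split; [lra|lra|move=> i].
  have := dL i; have [] := wzQ i; rewrite wQ zQ mulrDl => *; apply/andP; split; lra.
exists lo, (hi - d); rewrite lenE; split; [lra|lra|move=> i].
have := dL i; have [] := wzQ i; rewrite wQ zQ mulrBl => *; apply/andP; split; lra.
Qed.

End nonneg_matrices.

(** * Infinitely many good steps force an affine distribution function *)

Section affine.
Variables (R : realType) (n : nat).
Hypothesis n_gt0 : (0 < n)%N.
Implicit Types (s : state n) (l : 'rV[R]_n.+1).
Variable F : R -> R.
Variable gam : state n -> seq bool.
Variable L : R.
Hypothesis L1 : 1 <= L.
Hypothesis gamP : forall s, irreducible s ->
  forall i j, 1 <= (descend (s, 1%:M : 'M[R]_n.+1) (gam s)).2 i j <= L.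

Definition admissible s l := [/\ irreducible s, nonneg l, 0 < total l,
  equivariant s l F & forall x y, 0 <= x -> x <= y -> y <= total l -> F x <= F y].

Lemma admissible_induce s l : admissible s l ->
  admissible (induce (s, l)).1 (induce (s, l)).2 /\
  increments (induce (s, l)).1 (induce (s, l)).2 F =
    vec_step (choice_of s l) s (increments s l F).
Proof.
move=> [irrs l0 t0 eqF mF]; rewrite /induce /=; set e := choice_of s l.
have [eqF' incF'] := equivariant_rauzy n_gt0 irrs l0 (loser_le_winner s l) eqF.
have l0' : nonneg (vec_step e s l) by exact: nonneg_vec_step.
split=> //; split => //.
- exact: irreducible_rauzy.
- rewrite lt_neqAle eq_sym sumr_ge0 // andbT; apply/eqP => /eqP.
  rewrite psumr_eq0 => [/allP all0|i _]; last exact: l0'.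
  have l'E : vec_step e s l = 0.
    by apply/rowP => i; rewrite [RHS]mxE; have /= /eqP := all0 i (mem_index_enum i).
  have := vec_stepK n_gt0 e l 1%:M irrs; rewrite l'E mul0mx mulmx1 => lE.
  by move: t0; rewrite -lE /total big1 ?ltxx // => i _; rewrite mxE.
- move=> x y x0 xy yt; apply: mF => //; apply: le_trans yt _.
  by rewrite total_vec_step gerBl.
Qed.

Lemma increments_ge0 s l : admissible s l -> nonneg (increments s l F).
Proof.
move=> [irrs l0 t0 eqF mF] i; rewrite mxE subr_ge0; apply: mF.
- exact: pos_ge0.
- by rewrite lerDl.
- exact: pos_total.
Qed.

Lemma admissible_iter s l k : admissible s l ->
  let sl := iter k (@induce R n) (s, l) in
  [/\ admissible sl.1 sl.2, total sl.2 <= total l &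
    exists P : 'M[R]_n.+1, [/\ forall i j, 0 <= P i j, l = sl.2 *m P &
      increments s l F = increments sl.1 sl.2 F *m P]].
Proof.
elim: k s l => [|k IH] s l adm.
  split => //; exists 1%:M; split; rewrite ?mulmx1 // => i j.
  by rewrite mxE; case: eqP.
have [adm' inc'] := admissible_induce adm.
have [h1 h2 [P [P0 PE1 PE2]]] := IH _ _ adm'.
have [irrs l0 t0 _ _] := adm.
rewrite iterSr [induce (s, l)]surjective_pairing.
split => //.
  by apply: le_trans h2 _; rewrite total_vec_step gerBl.
exists (P *m row_step (choice_of s l) s 1%:M); split.
- move=> i j; rewrite mxE sumr_ge0 // => h _; rewrite mulr_ge0 // row_stepE.
  by rewrite !mxE addr_ge0 ?mulrn_wge0 //; case: eqP.
- by rewrite mulmxA -PE1 vec_stepK // mulmx1.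
- by rewrite mulmxA -PE2 inc' vec_stepK // mulmx1.
Qed.

Lemma follows_iter s l C g : admissible s l -> follows s l g ->
  let sl := iter (size g) (@induce R n) (s, l) in
  l *m C = sl.2 *m (descend (s, C) g).2 /\
  increments s l F *m C = increments sl.1 sl.2 F *m (descend (s, C) g).2.
Proof.
elim: g s l C => // e g IH s l C adm; rewrite [follows _ _ _]/=.
move=> /andP[/eqP eE fg].
have [irrs _ _ _ _] := adm.
have [adm' inc'] := admissible_induce adm.
have indE : induce (s, l) = (rauzy e s, vec_step e s l) by rewrite /induce /= eE.
rewrite indE eE in adm' inc'.
have [h1 h2] := IH _ _ (row_step e s C) adm' fg.
rewrite [size _]/= iterSr indE; split.
  by rewrite -h1 vec_stepK.
by rewrite -h2 inc' vec_stepK.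
Qed.

Definition infinitely_often s l := forall N, exists2 k, (N <= k)%N &
  follows (iter k (@induce R n) (s, l)).1 (iter k (@induce R n) (s, l)).2
    (gam (iter k (@induce R n) (s, l)).1).

(** A good step also halves the total length: each of the [n.+1] coordinates of [sl.2 *m Q] is at
    least [total sl.2], and [n.+1] is at least 2. *)
Lemma next_good s l : admissible s l -> infinitely_often s l ->
  exists (k : nat) (Q P : 'M[R]_n.+1),
  let sl := iter k (@induce R n) (s, l) in
  [/\ admissible sl.1 sl.2 /\ infinitely_often sl.1 sl.2,
      forall i j, 1 <= Q i j <= L, forall i j, 0 <= P i j,
      l = sl.2 *m Q *m P /\ increments s l F = increments sl.1 sl.2 F *m Q *m P
    & 2 * total sl.2 <= total l].
Proof.
move=> adm io; have [k _ fk] := io 0.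
have [admk tk [P [P0 PE1 PE2]]] := admissible_iter k adm.
set sk := iter k _ (s, l) in fk admk tk PE1 PE2.
rewrite (surjective_pairing sk) in fk.
have [irrk lk0 _ _ _] := admk.
have [e1 e2] := follows_iter 1%:M admk fk; rewrite !mulmx1 -surjective_pairing in e1 e2.
set g := gam _ in e1 e2; set Q := (descend _ _).2 in e1 e2.
have Q1 i j : 1 <= Q i j <= L by exact: gamP.
exists (size g + k)%N, Q, P; rewrite iterD -/sk.
have [adm' t' _] := admissible_iter (size g) admk.
rewrite -surjective_pairing in adm' t'.
split => //.
- split => // N; have [k' k'N fk'] := io (N + (size g + k))%N.
  exists (k' - (size g + k))%N; first by lia.
  rewrite -surjective_pairing /sk -[iter (size g) _ _]iterD -iterD subnK //.
  exact: leq_trans (leq_addl _ _) k'N.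
- by rewrite -e1 -e2.
apply: le_trans tk; rewrite e1 /total.
have [_ l'0 _ _ _] := adm'; set l' := (iter _ _ _).2 in l'0 *.
apply: (@le_trans _ _ (\sum_(i < n.+1) total l')).
  rewrite sumr_const card_ord -[leRHS]mulr_natl ler_wpM2r ?sumr_ge0 //.
  by rewrite ler_nat.
by apply: ler_sum => i _; have /andP[] := mulmx_positive_bounds l'0 Q1 i.
Qed.

Lemma total_small s l : admissible s l -> infinitely_often s l ->
  forall j, exists k, total (iter k (@induce R n) (s, l)).2 <= total l * (2^-1) ^+ j.
Proof.
move=> adm io j; elim: j s l adm io => [|j IH] s l adm io.
  by exists 0 => /=; rewrite expr0 mulr1.
have [k [Q [P [[adm' io'] _ _ _ t2]]]] := next_good adm io.
have [k' h] := IH _ _ adm' io'.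
exists (k' + k)%N; rewrite iterD; rewrite -surjective_pairing in h.
apply: le_trans h _; rewrite exprS mulrA ler_wpM2r ?exprn_ge0 ?invr_ge0 //.
rewrite ler_pdivlMr // mulrC; exact: t2.
Qed.

Definition ratio_in s l (lo hi : R) := forall i,
  lo * l 0 i <= increments s l F 0 i <= hi * l 0 i.

(** The hypothesis on [rho] passes to induced pairs, because nonnegative matrices carry lower bounds
    on the ratios back. One good step turns it into the upper bound [L * L * rho] for all ratios;
    the other [j] good steps contract. *)
Lemma ratio_oscillation (rho : R) j s l : admissible s l -> infinitely_often s l ->
  (forall c, (forall i, c * l 0 i <= increments s l F 0 i) -> c <= rho) ->
  exists lo hi, [/\ lo <= hi, ratio_in s l lo hi &
    hi - lo <= L * L * rho * (1 - (2 * L)^-1) ^+ j].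
Proof.
have L0 : 0 < L by exact: lt_le_trans L1.
have pull (u v : 'rV[R]_n.+1) (P Q : 'M[R]_n.+1) (c : R) : (forall i j, 0 <= P i j) ->
    (forall i, c * (u *m Q) 0 i <= (v *m Q) 0 i) ->
    forall i, c * (u *m Q *m P) 0 i <= (v *m Q *m P : 'rV[R]_n.+1) 0 i.
  move=> P0 h i.
  have -> : c * (u *m Q *m P) 0 i = (c *: (u *m Q) *m P) 0 i.
    by rewrite -scalemxAl [RHS]mxE.
  have E k : (c *: (u *m Q)) 0 k = c * (u *m Q) 0 k by rewrite mxE.
  by apply: ler_mulmx => // k; rewrite E; exact: h.
have pull' (u v : 'rV[R]_n.+1) (P Q : 'M[R]_n.+1) (c : R) : (forall i j, 0 <= P i j) ->
    (forall i, (v *m Q) 0 i <= c * (u *m Q) 0 i) ->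
    forall i, (v *m Q *m P : 'rV[R]_n.+1) 0 i <= c * (u *m Q *m P) 0 i.
  move=> P0 h i.
  have -> : c * (u *m Q *m P) 0 i = (c *: (u *m Q) *m P) 0 i.
    by rewrite -scalemxAl [RHS]mxE.
  have E k : (c *: (u *m Q)) 0 k = c * (u *m Q) 0 k by rewrite mxE.
  by apply: ler_mulmx => // k; rewrite E; exact: h.
elim: j s l => [|j IH] s l adm io hrho;
  have [k [Q [P [[adm' io'] Q1 P0 [lE incE] _]]]] := next_good adm io;
  set s' := (iter k _ _).1 in adm' io' incE; set l' := (iter k _ _).2 in adm' io' lE incE;
  have l'0 : nonneg l' by case: adm'.
- have t'0 : 0 < total l' by case: adm'.
  have i'0 := increments_ge0 adm'; set m' := increments s' l' F in i'0 incE.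
  have lb i := mulmx_positive_bounds l'0 Q1 i.
  have mb i := mulmx_positive_bounds i'0 Q1 i.
  have u'0 : 0 <= total m' by apply: sumr_ge0.
  have crho : total m' / (L * total l') <= rho.
    apply: hrho; rewrite incE lE; apply: pull => // i.
    have /andP[_ h1] := lb i; have /andP[h2 _] := mb i.
    rewrite mulrAC ler_pdivrMr ?mulr_gt0 // ler_pM //.
    by have /andP[h _] := lb i; apply: le_trans h; rewrite ltW.
  have hi0 : 0 <= L * L * rho.
    rewrite !mulr_ge0 ?(ltW L0) //; apply: le_trans crho.
    by rewrite divr_ge0 // mulr_ge0 // ltW.
  exists 0, (L * L * rho); rewrite subr0 expr0 mulr1; split => // i.
  rewrite mul0r increments_ge0 //= incE lE; apply: pull' => // {}i.
  have /andP[h1 _] := lb i; have /andP[_ h2] := mb i.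
  apply: le_trans h2 _; rewrite ler_pdivrMr ?mulr_gt0 // in crho.
  apply: (@le_trans _ _ (L * L * rho * total l')); last by rewrite ler_wpM2l.
  have -> : L * L * rho * total l' = L * (rho * (L * total l')) by ring.
  by rewrite ler_pM2l.
have [|lo [hi [lohi rat osc]]] := IH s' l' adm' io'.
  move=> c hc; apply: hrho => i; rewrite incE lE.
  apply: pull => // {}i.
  have -> : c * (l' *m Q) 0 i = (c *: l' *m Q) 0 i by rewrite -scalemxAl [RHS]mxE.
  apply: ler_mulmx => [a b|a]; last by have := hc a; rewrite [(c *: l') 0 a]mxE.
  by have /andP[h _] := Q1 a b; rewrite (le_trans _ h).
have [lo' [hi' [lohi' osc' rat']]] := positive_contraction L1 l'0 Q1 lohi rat.
exists lo', hi'; split => //.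
  move=> i; rewrite incE lE pull ?pull' // => {}i; by case/andP: (rat' i).
apply: le_trans osc' _; rewrite exprS mulrCA ler_wpM2l //.
by rewrite subr_ge0 invf_le1 ?mulr_gt0 //; move: L1; lra.
Qed.

Lemma increments_proportional s l : admissible s l -> infinitely_often s l ->
  increments s l F = (total (increments s l F) / total l) *: l.
Proof.
move=> adm io; have [_ l0 t0 _ _] := adm.
set m := increments s l F; set c := _ / _.
have inc0 := increments_ge0 adm.
have L0 : 0 < L by exact: lt_le_trans L1.
have cmax c' : (forall i, c' * l 0 i <= m 0 i) -> c' <= c.
  move=> h; rewrite ler_pdivlMr // /total mulr_sumr; exact: ler_sum.
have c0 : 0 <= c by rewrite divr_ge0 ?sumr_ge0 ?ltW.
apply/rowP => i; rewrite [RHS]mxE; apply/eqP; rewrite -subr_eq0 -normr_le0.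
apply/ler_addgt0Pr => e e0; rewrite add0r.
pose th := 1 - (2 * L)^-1.
have th1 : th < 1 by rewrite /th ltrBlDr ltrDl invr_gt0 mulr_gt0.
have th0 : 0 <= th by rewrite subr_ge0 invf_le1 ?mulr_gt0 //; move: L1; lra.
have [j hj] := geometric_small (L * L * c * l 0 i) th0 th1 e0.
have [lo [hi [lohi rat osc]]] := ratio_oscillation j adm io cmax.
have loc : lo <= c by apply: cmax => k; case/andP: (rat k).
have hic : c <= hi.
  by rewrite ler_pdivrMr // /total mulr_sumr; apply: ler_sum => k _; case/andP: (rat k).
apply: le_trans hj.
have -> : L * L * c * l 0 i * th ^+ j = L * L * c * th ^+ j * l 0 i by ring.
apply: (@le_trans _ _ ((hi - lo) * l 0 i)); last by rewrite ler_wpM2r.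
have /andP[r1 r2] := rat i.
have h1 : lo * l 0 i <= c * l 0 i by rewrite ler_wpM2r.
have h2 : c * l 0 i <= hi * l 0 i by rewrite ler_wpM2r.
rewrite mulrBl ler_norml; apply/andP; split; lra.
Qed.

(** On the interval reached after [k] steps monotonicity alone bounds the deviation by the total
    mass; [affine_step] carries this bound back to the whole interval. *)
Lemma affine_iter k c s l : admissible s l -> increments s l F = c *: l -> 0 <= c ->
  forall y, 0 <= y <= total l ->
    `|F y - F 0 - c * y| <= c * total (iter k (@induce R n) (s, l)).2.
Proof.
elim: k s l => [|k IH] s l adm incE c0.
  have [irrs l0 t0 eqF mF] := adm.
  have inc1 i : F (pos s.1 l i + l 0 i) - F (pos s.1 l i) = c * l 0 i.
    by move/rowP: incE => /(_ i); rewrite !mxE.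
  have Ft : F (total l) = F 0 + c * total l.
    have := inc1 (winner true s); rewrite (pos_affine inc1) pos_last_top subrK.
    move=> /eqP; rewrite subr_eq => /eqP ->; ring.
  move=> y /andP[y0 yt] /=.
  have h1 := mF 0 y (lexx 0) y0 yt; have h2 := mF y (total l) y0 yt (lexx _).
  have h3 : c * y <= c * total l by rewrite ler_wpM2l.
  have h4 : 0 <= c * y by rewrite mulr_ge0.
  rewrite Ft in h2; rewrite ler_norml; apply/andP; split; lra.
have [irrs l0 t0 eqF mF] := adm.
have [adm' inc'] := admissible_induce adm.
apply: (affine_step n_gt0 irrs l0 (loser_le_winner s l) eqF incE).
rewrite iterSr [induce (s, l)]surjective_pairing; apply: IH => //.
by rewrite inc' incE /vec_step -scalemxAl.
Qed.

Lemma affine_of_infinitely_often s l : admissible s l -> infinitely_often s l ->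
  forall y, 0 <= y <= total l ->
    F y = F 0 + total (increments s l F) / total l * y.
Proof.
move=> adm io y yl; have [_ l0 t0 _ _] := adm.
have incE := increments_proportional adm io; set c := _ / _ in incE *.
have c0 : 0 <= c.
  by rewrite divr_ge0 ?(ltW t0) // sumr_ge0 // => i _; exact: increments_ge0.
apply/eqP; rewrite -subr_eq0 opprD addrA -normr_le0.
apply/ler_addgt0Pr => e e0; rewrite add0r.
have [j hj] := @geometric_small R (c * total l) 2^-1 e
  (ltac:(by rewrite invr_ge0)) (ltac:(by rewrite invf_lt1 // ltr1n)) e0.
have [k hk] := total_small adm io j.
apply: le_trans (affine_iter k adm incE c0 yl) _.
apply: le_trans hj; rewrite -[leRHS]mulrA; exact: ler_wpM2l.
Qed.

End affine.

(** * Unique ergodicity *)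

Section lebesgue_translation.
Local Open Scope classical_set_scope.
Variable R : realType.

Lemma measurable_shift (c : R) :
  measurable_fun [set: measurableTypeR R]
    (fun x : measurableTypeR R => x + c : measurableTypeR R).
Proof. by apply: measurable_funD => //; exact: measurable_cst. Qed.

Lemma lebesgue_measure_shift (c : R) (A : set (measurableTypeR R)) : measurable A ->
  lebesgue_measure ((fun x : measurableTypeR R => x + c) @^-1` A) = lebesgue_measure A.
Proof.
move=> mA.
pose f : {mfun measurableTypeR R >-> measurableTypeR R} :=
  HB.pack (fun x : measurableTypeR R => x + c : measurableTypeR R)
    (isMeasurableFun.Build _ _ _ _ _ (measurable_shift c)).
rewrite -[LHS]/(pushforward lebesgue_measure f A).
rewrite -(@lebesgue_measure_unique R (pushforward lebesgue_measure f)) //.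
move=> X [[a b] /= _ <-].
rewrite /pushforward.
have -> : f @^-1` `]a, b]%classic = `]a - c, b - c]%classic.
  by apply/seteqP; split => x /=; rewrite !in_itv /= ltrBlDr lerBrDr.
rewrite !lebesgue_measure_itv /= !lte_fin ltrD2r -!EFinB.
by congr (if _ then _%:E else _); ring.
Qed.

End lebesgue_translation.

Section cells.
Local Open Scope classical_set_scope.
Variables (R : realType) (n : nat).
Implicit Types (p : 'S_n.+1) (l : 'rV[R]_n.+1).

(** For the row [1%g] these are the exchanged intervals, for the row [p] their images. *)
Definition cell p l i : set (measurableTypeR R) :=
  `[pos p l i, pos p l i + l 0 i[%classic.

Lemma measurable_cell p l i : measurable (cell p l i).
Proof. exact: measurable_itv. Qed.

Lemma cell_uniq p l i j x : nonneg l -> cell p l i x -> cell p l j x -> i = j.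
Proof.
move=> l0; rewrite /cell /= !in_itv /= => /andP[i1 i2] /andP[j1 j2].
case: (ltngtP (p i) (p j)) => [ij|ji|/val_inj/perm_inj//].
  by have := le_lt_trans j1 (lt_le_trans i2 (pos_lt l0 ij)); rewrite ltxx.
by have := le_lt_trans i1 (lt_le_trans j2 (pos_lt l0 ji)); rewrite ltxx.
Qed.

Lemma cell_cover p l x : nonneg l -> 0 <= x < total l -> exists i, cell p l i x.
Proof.
move=> l0 /andP[x0 xt].
pose i0 := (p^-1)%g ord0.
have pi0 : pos p l i0 <= x.
  by rewrite /pos big1 // => j; rewrite /i0 permKV ltn0.
pose i := [arg max_(j > i0 | (pos p l j <= x)%R) (p j : nat)]%N.
have [ix imax] : pos p l i <= x /\ forall j, pos p l j <= x -> (p j <= p i)%N.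
  by rewrite /i; case: arg_maxnP.
exists i; rewrite /cell /= in_itv /= ix /= ltNge; apply/negP => le.
have [pin|pin] := eqVneq (p i) ord_max.
  suff E : total l = pos p l i + l 0 i by move: xt; rewrite E ltNge le.
  rewrite /total (bigD1 i) //= addrC; congr (_ + _); apply: eq_bigl => j.
  rewrite pin; have [->|ji] := eqVneq j i; first by rewrite pin /= ltnn.
  have := leq_ord (p j); rewrite leq_eqVlt => /orP[/eqP pj|-> //].
  case/eqP: ji; apply: (@perm_inj _ p); apply: val_inj.
  by rewrite pin.
have pin' : (p i < n)%N.
  have := leq_ord (p i); rewrite leq_eqVlt => /orP[/eqP pj|//].
  by case/eqP: pin; exact: val_inj.
pose i' := (p^-1)%g (inord (p i).+1).
have pi' : p i' = (p i).+1 :> nat by rewrite permKV inordK.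
have : (p i' <= p i)%N.
  apply: imax; apply: le_trans le.
  rewrite /pos (bigD1 i) /=; last by rewrite pi'.
  rewrite addrC lerD2r le_eqVlt; apply/orP; left; apply/eqP; apply: eq_bigl => j.
  rewrite pi' -(inj_eq (@perm_inj _ p)) -val_eqE /=.
  by rewrite ltnS ltn_neqAle andbC.
by rewrite pi' ltnn.
Qed.

Variables (l : 'rV[R]_n.+1) (p : 'S_n.+1).
Hypothesis l0 : nonneg l.

Lemma iet_leftE i : iet_left l i = pos 1%g l i.
Proof. by apply: eq_bigl => j; rewrite !perm1. Qed.

Lemma in_pieceE i x : in_piece l i x <-> cell 1%g l i x.
Proof. by rewrite /in_piece iet_leftE /cell /= in_itv. Qed.

Lemma vec_sumE : vec_sum l = total l. Proof. by []. Qed.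

Lemma iet_domP x : iet_dom l x <-> exists i, cell 1%g l i x.
Proof.
split => [/(cell_cover 1%g l0)//|[i]]; rewrite /cell /iet_dom /= in_itv /=.
move=> /andP[h1 h2]; rewrite (le_trans (pos_ge0 _ _ l0) h1) /=.
exact: lt_le_trans h2 (pos_total _ _ l0).
Qed.

Lemma iet_cell i x : cell 1%g l i x -> iet l p x = x + (pos p l i - pos 1%g l i).
Proof.
move=> xi; rewrite /iet (big_pred1 i); first by congr (_ + (_ - _)); rewrite -iet_leftE.
move=> j; apply/idP/eqP => [/in_pieceE xj|->]; last exact/in_pieceE.
exact: cell_uniq l0 xj xi.
Qed.

Lemma iet_in_cell i x : cell 1%g l i x -> cell p l i (iet l p x).
Proof.
move=> xi; rewrite (iet_cell xi); move: xi; rewrite /cell /= !in_itv /=.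
move=> /andP[h1 h2]; apply/andP; split; lra.
Qed.

Lemma preimage_iet_cell i A : A `<=` cell p l i ->
  iet_dom l `&` iet l p @^-1` A =
  (fun x : measurableTypeR R => x + (pos p l i - pos 1%g l i)) @^-1` A.
Proof.
move=> Ai; apply/seteqP; split => x.
  move=> [/iet_domP[j xj] /= Ax]; have jE := iet_in_cell xj.
  have E := cell_uniq l0 jE (Ai _ Ax); subst j.
  by rewrite -(iet_cell xj).
move=> /= Ax; have xi : cell 1%g l i x.
  have := Ai _ Ax; rewrite /cell /= !in_itv /= => /andP[h1 h2]; apply/andP; split; lra.
by split; [apply/iet_domP; exists i|rewrite (iet_cell xi)].
Qed.

Lemma iet_dom_itv : iet_dom l = `[0, total l[%classic.
Proof. by apply/seteqP; split => x; rewrite /iet_dom /= in_itv. Qed.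

Lemma measurable_iet_dom : measurable (iet_dom l : set (measurableTypeR R)).
Proof. by rewrite iet_dom_itv; exact: measurable_itv. Qed.

Lemma preimage_iet_bigcup (A : set (measurableTypeR R)) :
  iet_dom l `&` iet l p @^-1` A =
  \bigcup_(i in [set: 'I_n.+1])
    ((fun x : measurableTypeR R => x + (pos p l i - pos 1%g l i)) @^-1` (A `&` cell p l i)).
Proof.
apply/seteqP; split => x.
  move=> [dx Ax]; have [i xi] := (iet_domP x).1 dx; exists i => //.
  rewrite -(preimage_iet_cell (@subIsetr _ A _)).
  by split => //; split => //; exact: iet_in_cell.
move=> [i _]; rewrite -(preimage_iet_cell (@subIsetr _ A _)) => -[dx [Ax _]].
by split.
Qed.

Lemma bigcup_cell (A : set (measurableTypeR R)) :
  A `&` iet_dom l = \bigcup_(i in [set: 'I_n.+1]) (A `&` cell p l i).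
Proof.
apply/seteqP; split => x.
  by move=> [Ax /(cell_cover p l0) [i xi]]; exists i.
move=> [i _ [Ax]]; rewrite iet_dom_itv /cell /= !in_itv /= => /andP[h1 h2]; split => //.
rewrite (le_trans (pos_ge0 _ _ l0) h1) /=; exact: lt_le_trans h2 (pos_total _ _ l0).
Qed.

Lemma lebesgue_preimage_iet (A : set (measurableTypeR R)) : measurable A ->
  measurable (iet_dom l `&` iet l p @^-1` A : set (measurableTypeR R)) /\
  lebesgue_measure (iet_dom l `&` iet l p @^-1` A : set (measurableTypeR R)) =
  lebesgue_measure (A `&` iet_dom l : set (measurableTypeR R)).
Proof.
move=> mA; have mAi i : measurable (A `&` cell p l i).
  by apply: measurableI => //; exact: measurable_cell.
have mS i : measurable ((fun x : measurableTypeR R => x + (pos p l i - pos 1%g l i))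
    @^-1` (A `&` cell p l i) : set (measurableTypeR R)).
  rewrite -[X in measurable X]setTI; apply: measurable_shift => //.
have fin : finite_set [set: 'I_n.+1] by exact: finite_finset.
split; first by rewrite preimage_iet_bigcup; exact: fin_bigcup_measurable.
rewrite preimage_iet_bigcup bigcup_cell !measure_fin_bigcup //.
- by apply: eq_fsbigr => i _; exact: lebesgue_measure_shift.
- by move=> i j _ _ [x [[_ xi] [_ xj]]]; exact: cell_uniq l0 xi xj.
- move=> i j _ _ [x []]; rewrite -!(preimage_iet_cell (@subIsetr _ A _)).
  by move=> [_ [_ xi]] [_ [_ xj]]; exact: cell_uniq l0 xi xj.
Qed.

Section unique.
Hypothesis t0 : 0 < total l.
Variable mu : probability (measurableTypeR R) R.

Lemma normalized_lebesgue_invariant :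
  (forall A : set (measurableTypeR R), measurable A ->
    mu A = (lebesgue_measure (A `&` iet_dom l) * ((vec_sum l)^-1)%:E)%E) ->
  iet_invariant l p mu.
Proof.
move=> muE; split.
  rewrite muE; last exact: measurable_iet_dom.
  rewrite setIid iet_dom_itv lebesgue_measure_itv /= lte_fin t0 oppr0 adde0.
  by rewrite vec_sumE -EFinM mulfV // gt_eqF.
move=> A mA; have [m1 m2] := lebesgue_preimage_iet mA.
by rewrite !muE // -m2 setIAC setIid.
Qed.

Hypothesis inv : iet_invariant l p mu.

Definition mass (y : R) : R := fine (mu `[0, y[%classic).

Lemma massB a b : 0 <= a -> a <= b -> mass b - mass a = fine (mu `[a, b[%classic).
Proof.
move=> a0 ab; have E : `[0, b[%classic = `[0, a[%classic `|` `[a, b[%classic :> set R.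
  by rewrite -itv_bndbnd_setU // bnd_simp.
rewrite /mass E measureU //; last first.
  apply/seteqP; split => // x [] /=; rewrite !in_itv /= => /andP[_ h] /andP[h' _].
  by move: (lt_le_trans h h'); rewrite ltxx.
by rewrite fineD ?fin_num_measure // addrAC subrr add0r.
Qed.

Lemma mass_equivariant : equivariant (1%g, p) l mass.
Proof.
move=> i y /andP[y0 yl] /=.
rewrite !massB ?lerDl ?pos_ge0 //; congr fine.
have [_ h] := inv.
rewrite -[RHS]h; last exact: measurable_itv.
rewrite (@preimage_iet_cell i).
  congr (mu _); apply/seteqP; split => x /=; rewrite !in_itv /= => /andP[? ?];
    apply/andP; split; lra.
move=> x; rewrite /cell /= !in_itv /= => /andP[-> h2] /=.
by apply: lt_le_trans h2 _; rewrite lerD2l.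
Qed.

Lemma mass0 : mass 0 = 0.
Proof. by rewrite /mass set_itvco0 ?measure0. Qed.

Lemma mass_total : mass (total l) = 1.
Proof. by rewrite /mass -iet_dom_itv (proj1 inv). Qed.

Lemma mass_admissible : irreducible (1%g, p) -> admissible mass (1%g, p) l.
Proof.
move=> irr; split => //; first exact: mass_equivariant.
move=> x y x0 xy _; rewrite -subr_ge0 massB //; exact: fine_ge0.
Qed.

(** The half-lines []-oo, x[] generate the Borel sets and are closed under intersection; [mu]
    vanishes outside the domain, so [mass] gives its values on them. *)
Lemma measure_of_linear_mass :
  (forall y, 0 <= y <= total l -> mass y = y / total l) ->
  forall A : set (measurableTypeR R), measurable A ->
    mu A = (lebesgue_measure (A `&` iet_dom l) * ((vec_sum l)^-1)%:E)%E.
Proof.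
move=> massE A mA; rewrite muleC vec_sumE.
have mD := measurable_iet_dom.
have k0 : 0 <= (total l)^-1 by rewrite invr_ge0 ltW.
pose m2 := mscale (NngNum k0) (mrestr lebesgue_measure mD).
rewrite -[RHS]/(m2 A).
pose m2' : {measure set (measurableTypeR R) -> \bar R} := m2.
pose g (k : nat) : set (measurableTypeR R) := `]-oo, k%:R[%classic.
have mG : @measurable _ (measurableTypeR R) = <<s (@RGenInftyO.G R) >>.
  exact: RGenInftyO.measurableE.
have setIG : setI_closed (@RGenInftyO.G R).
  move=> _ _ [x ->] [y ->]; exists (Num.min x y); apply/seteqP; split => z /=.
    by rewrite !in_itv /= lt_min => -[-> ->].
  by rewrite !in_itv /= lt_min => /andP[].
have Gg i : @RGenInftyO.G R (g i) by exists i%:R.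
have gcov : \bigcup_k g k = setT.
  apply/seteqP; split => // x _; exists (Num.truncn `|x|).+1 => //=.
  rewrite /g /= in_itv /=; apply: le_lt_trans (ler_norm x) _; exact: truncnS_gt.
have muD (B : set (measurableTypeR R)) : measurable B -> mu B = mu (B `&` iet_dom l).
  move=> mB.
  have N : mu (~` (iet_dom l : set (measurableTypeR R))) = 0%E.
    by rewrite probability_setC // (proj1 inv) subee.
  have N' : mu (B `\` (iet_dom l : set (measurableTypeR R))) = 0%E.
    apply: subset_measure0 N; [exact: measurableD|exact: measurableC|].
    by move=> x [].
  apply: etrans (measureDI mu mB mD) _; apply: etrans (add0e _).
  by congr (_ + _)%E; exact: N'.
apply: (@measure_unique _ R (measurableTypeR R) (@RGenInftyO.G R) g mG setIG Gg gcov
  mu m2') => //; last first.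
  by move=> k; apply: le_lt_trans (probability_le1 mu _) (ltry 1); exact: measurable_itv.
move=> _ [x ->].
have mX : measurable (`]-oo, x[%classic : set (measurableTypeR R)) by exact: measurable_itv.
suff h : mu (`]-oo, x[%classic `&` iet_dom l) =
    (((total l)^-1)%:E * lebesgue_measure (`]-oo, x[%classic `&` iet_dom l))%E.
  exact: etrans (muD _ mX) h.
have -> : `]-oo, x[%classic `&` iet_dom l = `[0, Num.min x (total l)[%classic.
  rewrite iet_dom_itv; apply/seteqP; split => z /=; rewrite !in_itv /= lt_min.
    by move=> [-> /andP[-> ->]].
  by move=> /and3P[-> -> ->].
have [x0|x0] := leP x 0.
  rewrite (_ : `[0, Num.min x (total l)[%classic = set0); last first.
    by apply/seteqP; split => // z /=; rewrite in_itv /= lt_min; lra.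
  by rewrite !measure0 mule0.
rewrite lebesgue_measure_itv /= lte_fin lt_min x0 t0 /= oppr0 adde0.
have m01 : 0 <= Num.min x (total l) <= total l.
  by rewrite le_min ltW //= ltW //= ge_min lexx orbT.
rewrite -EFinM mulrC -massE // /mass fineK // fin_num_measure //.
Qed.

Lemma linear_mass : irreducible (1%g, p) -> (0 < n)%N ->
  forall (gam : state n -> seq bool) (L : R), 1 <= L ->
  (forall s, irreducible s ->
    forall i j, 1 <= (descend (s, 1%:M : 'M[R]_n.+1) (gam s)).2 i j <= L) ->
  infinitely_often gam (1%g, p) l ->
  forall y, 0 <= y <= total l -> mass y = y / total l.
Proof.
move=> irr n0 gam L L1 gamP io.
have lin := affine_of_infinitely_often n0 L1 gamP (mass_admissible irr) io.
set c := total _ / _ in lin.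
have : mass (total l) = mass 0 + c * total l by apply: lin; rewrite ltW // lexx.
rewrite mass0 mass_total add0r => c1 y yl; rewrite lin // mass0 add0r.
have tN : total l != 0 by rewrite gt_eqF.
have -> : c = (total l)^-1 by rewrite -[LHS](mulfK tN) -c1 mul1r.
exact: mulrC.
Qed.

End unique.

Lemma uniquely_ergodic_of_infinitely_often (gam : state n -> seq bool) (L : R) :
  (0 < n)%N -> 0 < total l -> irreducible (1%g, p) -> 1 <= L ->
  (forall s, irreducible s ->
    forall i j, 1 <= (descend (s, 1%:M : 'M[R]_n.+1) (gam s)).2 i j <= L) ->
  infinitely_often gam (1%g, p) l -> uniquely_ergodic l p.
Proof.
move=> n0 t0 irr L1 gamP io mu; split; last exact: normalized_lebesgue_invariant.
move=> inv; apply: measure_of_linear_mass => //.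
exact: (linear_mass t0 inv irr n0 L1 gamP io).
Qed.

End cells.

(** * Passage to projective classes and to the nodes of the tree *)

Section scaling.
Variables (R : realType) (n : nat).
Hypothesis n_gt0 : (0 < n)%N.
Implicit Types (s : state n) (l y : 'rV[R]_n.+1) (g : seq bool).
Variable gam : state n -> seq bool.

Lemma choice_of_scale (c : R) s l : 0 < c -> choice_of s (c *: l) = choice_of s l.
Proof. by move=> c0; rewrite /choice_of !mxE ler_pM2l. Qed.

Lemma vec_step_scale (c : R) e s l : vec_step e s (c *: l) = c *: vec_step e s l.
Proof. by rewrite /vec_step scalemxAl. Qed.

Lemma iter_induce_scale (c : R) k s l : 0 < c ->
  iter k (@induce R n) (s, c *: l) =
  ((iter k (@induce R n) (s, l)).1, c *: (iter k (@induce R n) (s, l)).2).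
Proof.
move=> c0; elim: k => //= k ->.
by rewrite /induce /= choice_of_scale // vec_step_scale.
Qed.

Lemma follows_scale (c : R) s l g : 0 < c -> follows s (c *: l) g = follows s l g.
Proof.
by move=> c0; elim: g s l => //= e g IH s l; rewrite choice_of_scale // vec_step_scale IH.
Qed.

Lemma bad_scale (c : R) (m : node R n) v : 0 < c -> bad gam m v -> bad gam m (c *: v).
Proof.
move=> c0 [y [y0 ny] <-]; exists (c *: y); last by rewrite scalemxAl.
split; first by move=> i; rewrite mxE mulr_ge0 // ltW.
by move=> k; rewrite iter_induce_scale //= follows_scale //; exact: ny.
Qed.

(** A vector with only finitely many good steps is bad for the node that it reaches after the last
    one; as nodes are indexed by finite words, countably many bad sets suffice. *)
Lemma bad_descend N s l C : irreducible s -> nonneg l ->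
  never gam (iter N (@induce R n) (s, l)).1 (iter N (@induce R n) (s, l)).2 ->
  exists g, bad gam (descend (s, C) g) (l *m C).
Proof.
elim: N s l C => [|N IH] s l C irrs l0; first by exists [::], l.
rewrite iterSr => nev.
have [g hg] := IH _ _ (row_step (choice_of s l) s C)
  (@irreducible_rauzy n n_gt0 (choice_of s l) s irrs) (nonneg_vec_step s l0) nev.
by exists (choice_of s l :: g); rewrite -(vec_stepK n_gt0 (choice_of s l) l C irrs).
Qed.

Lemma not_infinitely_often s l : ~ infinitely_often gam s l ->
  exists N, never gam (iter N (@induce R n) (s, l)).1 (iter N (@induce R n) (s, l)).2.
Proof.
move=> /existsNP[N hN]; exists N => k; apply/negP => hk; apply: hN.
exists (k + N)%N; first exact: leq_addl.
by rewrite iterD [iter N _ _]surjective_pairing.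
Qed.

End scaling.

Lemma gain_exponent (R : realType) (kap a : R) : 0 <= kap -> kap < 1 -> 1 <= a ->
  exists eta, 0 < eta < 1 /\ kap * a `^ eta < 1.
Proof.
move=> k0 k1 a1; have h0 : (0 : R) < 2^-1 by rewrite invr_gt0.
have [j hj] := geometric_small a k0 k1 h0.
have a0 : 0 <= a by exact: le_trans a1.
exists (j.+2%:R)^-1; split.
  by rewrite invr_gt0 ltr0n invf_lt1 ?ltr0n // ltr1n.
rewrite ltNge; apply/negP => /(exprn_ege1 j.+2).
rewrite exprMn -[(_ `^ _) ^+ _]powR_mulrn ?powR_ge0 // -powRrM mulVf ?pnatr_eq0 //.
rewrite powRr1 // leNgt => /negP; apply.
apply: (@le_lt_trans _ _ (2^-1 : R)); last by rewrite invf_lt1 // ltr1n.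
apply: le_trans hj; rewrite mulrC ler_wpM2l // !exprS mulrA ler_piMl ?exprn_ge0 //.
by rewrite mulr_ile1 // ltW.
Qed.

Local Open Scope classical_set_scope.

Lemma finely_covered_sub (R : realType) (T : metricType R) (s : R) (A B : set T) :
  A `<=` B -> finely_covered s B -> finely_covered s A.
Proof.
move=> AB hB e /hB [L [h1 h2 h3]]; exists L; split => //.
exact: subset_trans h1.
Qed.

Lemma finely_covered0 (R : realType) (T : metricType R) (s : R) :
  finely_covered s (set0 : set T).
Proof.
move=> e e0; exists [::]; split => //; first by move=> j; rewrite nth_nil diam_set0 leNye.
by rewrite big_nil lee_fin ltW.
Qed.

Lemma irreducible_root (n : nat) (p : 'S_n.+1) :
  irreducible_perm p -> irreducible (1%g, p).
Proof.
move=> hp k /andP[k0 kn] /= E; apply: (hp k); first by rewrite k0 ltnS.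
have {}E (i : 'I_n.+1) : (i < k)%N = (p i < k)%N.
  by move/setP: E => /(_ i); rewrite !inE perm1.
apply/setP => i; rewrite inE; apply/imsetP/idP => [[j]|ik].
  by rewrite inE E => pj ->.
by exists ((p^-1)%g i); rewrite ?permKV // inE E permKV.
Qed.

Lemma positive_paths (R : realType) (n : nat) : (0 < n)%N ->
  exists (gam : state n -> seq bool) (L : R), 1 <= L /\
  forall s, irreducible s ->
    forall i j, 1 <= (descend (s, 1%:M : 'M[R]_n.+1) (gam s)).2 i j <= L.
Proof.
move=> n0.
have ex s : exists g, irreducible s ->
    forall i j, 1 <= (descend (s, 1%:M : 'M[R]_n.+1) g).2 i j.
  have [irrs|h] := pselect (irreducible s); last by exists [::].
  by have [g hg] := positive_path R n0 irrs; exists g.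
have [gam Hgam] := choice ex.
pose P s := (descend (s, 1%:M : 'M[R]_n.+1) (gam s)).2.
exists gam, (1 + \sum_s \sum_i \sum_j `|P s i j|); split.
  by rewrite lerDl; apply: sumr_ge0 => s _; apply: sumr_ge0 => i _; exact: sumr_ge0.
move=> s irrs i j; rewrite Hgam //=.
have le : `|P s i j| <= \sum_s \sum_i \sum_j `|P s i j|.
  rewrite (bigD1 s) //= (bigD1 i) //= (bigD1 j) //= -!addrA lerDl.
  rewrite addr_ge0 ?sumr_ge0 // addr_ge0 ?sumr_ge0 // => k _; rewrite sumr_ge0 //.
  by move=> u _; exact: sumr_ge0.
by apply: le_trans (ler_norm _) _; apply: le_trans le _; rewrite lerDr.
Qed.

Theorem theorem4p2 (R : realType) (d : nat) (hd : (1 < d)%N)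
    (p : 'S_d) (hp : irreducible_perm p) :
  (hausdorff_dim (not_uniquely_ergodic_locus R p) < (d.-1%:R : R)%:E)%E.
Proof.
case: d hd p hp => // n n0 p hp; rewrite ltnS in n0; rewrite [n.+1.-1]/=.
have irr := irreducible_root hp.
have [gam [L [L1 gamP]]] := positive_paths R n0.
have [kap [K [k0 k1 K1 Hcov]]] := @coverable_iter R n n0 gam.
have [|eta [eta01 gain]] := @gain_exponent R kap (K ^+ n.+1) k0 k1.
  exact: exprn_ege1.
have s0 := s_gt0 n0 eta01.
set s := n%:R - eta in s0.
pose root : node R n := ((1%g, p), 1%:M).
pose U (g : seq bool) :=
  [set x : Pplus R n.+1 | bad gam (descend root g) (simplex_chart x)].
(* The words are listed by their codes; a number that codes no word contributes the empty set. *)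
pose V k := if unpickle k is Some g then U g else set0.
pose N := not_uniquely_ergodic_locus R p.
have fine k : finely_covered s (N `&` V k).
  apply: finely_covered_sub (@subIsetr _ _ _) _; rewrite /V.
  case: (unpickle k) => [g|]; last exact: finely_covered0.
  have wfm : wf (descend root g) by apply: wf_descend => //; exact: wf_root.
  apply: (bad_finely_covered n0 eta01 k0 k1 K1 gain wfm) => j M hM.
  exact: Hcov.
have cov : N = \bigcup_k (N `&` V k).
  apply/seteqP; split => [x Nx|x [k _ []]//].
  case: (Nx) => l /= nue lx.
  have l0 : nonneg (val l) by move=> i; apply/ltW/(forallP (valP l)).
  have t0 : 0 < total (val l).
    rewrite /total (bigD1 ord0) //= ltr_pwDl ?sumr_ge0 //.
    exact: (forallP (valP l)).
  have [M hM] : exists M, never gam (iter M (@induce R n) ((1%g, p), val l)).1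
      (iter M (@induce R n) ((1%g, p), val l)).2.
    apply: not_infinitely_often => io; apply: nue.
    exact: uniquely_ergodic_of_infinitely_often gamP io.
  have [g hg] := bad_descend n0 1%:M irr l0 hM.
  exists (pickle g) => //; split => //; rewrite /V pickleK /U /=.
  rewrite -lx simplex_chartE; apply: bad_scale; first by rewrite invr_gt0.
  by rewrite mulmx1 in hg.
apply: (@le_lt_trans _ _ s%:E).
  apply: ereal_inf_lbound; exists s => //=; split => //.
  by rewrite -/N cov; exact: hausdorff_measure_bigcup.
by rewrite lte_fin /s gtrBl; case/andP: eta01.
Qed.
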